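(* Let $G$ be a group that admits a nice $(2,1)$-presentation. Then either $G$ is isomorphic to $\mathbb{Z}^2$ or there exists a non-zero $\phi\in H^1(G;\mathbb{Z})=\operatorname{Hom}(G,\mathbb{Z})$ which does not represent an element of $\Sigma(G)$.
   Context: A nice $(2,1)$-presentation is a group presentation $\pi=\langle x,y\mid r\rangle$ with two generators and one relator such that $r$ is a non-empty cyclically reduced word and the presented group has first Betti number $b_1=2$. For a finitely generated group $G$ let $S(G)=(\operatorname{Hom}(G,\mathbb{R})\setminus\{0\})/\mathbb{R}_{>0}$. The Bieri--Neumann--Strebel invariant $\Sigma(G)\subset S(G)$ (in the original sign convention of Bieri--Neumann--Strebel) is: choose a finite generating set $S$ and consider the Cayley graph with vertex set $G$ and edges joining $g$ and $gs$ ($g\in G$, $s\in S$); then $[\phi]\in\Sigma(G)$ if and only if the full subgraph spanned by $\{g\in G\mid\phi(g)\le 0\}$ is connected (independent of $S$). In this convention an epimorphism $\phi\colon G\to\mathbb{Z}$ represents an element of $\Sigma(G)$ iff there is an isomorphism $G\cong\langle A,t\mid A=t^{-1}\varphi(A)t\rangle$ with $A$ finitely generated and $\varphi\colon A\to A$ a monomorphism, under which $\phi$ corresponds to $t\mapsto1$, $a\mapsto0$ for $a\in A$. *)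

(* Defs.v *)
From HB Require Import structures.
From mathcomp Require Import all_boot all_order all_algebra.
From mathcomp Require Import generic_quotient.
From mathcomp Require Import boolp classical_sets reals.

Set Implicit Arguments.
Unset Strict Implicit.
Unset Printing Implicit Defensive.

Import Order.TTheory GRing.Theory Num.Theory.

Local Open Scope classical_set_scope.
Local Open Scope ring_scope.

(* (x, false) stands for the generator x and (x, true) for its inverse. *)
Notation letter X := (X * bool)%type.
Notation word X := (seq (letter X)).

Section Presentation.
Variable X : choiceType.
Local Notation letter := (letter X).
Local Notation word := (word X).

Definition letter_inv (l : letter) : letter := (l.1, ~~ l.2).
Definition word_inv (w : word) : word := rev (map letter_inv w).

Definition cyclically_reduced (w : word) : bool :=
  cycle (fun l m : letter => m != letter_inv l) w.

Variable r : word.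

(* Equality of words in the group <X | r>: the congruence generated by free
   cancellation and r = 1, i.e. congruence modulo the normal closure of r in
   the free group on X. *)
Inductive pres_eq : word -> word -> Prop :=
| pres_refl w : pres_eq w w
| pres_sym u v : pres_eq u v -> pres_eq v u
| pres_trans v u w : pres_eq u v -> pres_eq v w -> pres_eq u w
| pres_cat u u' v v' : pres_eq u u' -> pres_eq v v' ->
    pres_eq (u ++ v) (u' ++ v')
| pres_cancel l : pres_eq [:: l; letter_inv l] [::]
| pres_rel : pres_eq r [::].

Definition pres_eqb (u v : word) : bool := `[< pres_eq u v >].

Lemma pres_eqb_equiv : equiv_class_of pres_eqb.
Proof.
split=> [u|u v|v u w]; first exact/asboolP/pres_refl.
- by apply/asboolP/asboolP => /pres_sym.
- by move=> /asboolP uv /asboolP vw; apply/asboolP/(pres_trans uv).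
Qed.
Canonical pres_equiv := EquivRelPack pres_eqb_equiv.

Definition pres_group : Type := {eq_quot pres_equiv}%qT.
HB.instance Definition _ := Choice.on pres_group.
HB.instance Definition _ := Quotient.on pres_group.

Local Notation pi := (\pi_pres_group%qT).

Lemma pres_piP u v : pi u = pi v <-> pres_eq u v.
Proof.
split=> [/eqmodP/asboolP //|uv].
exact/eqmodP/asboolP.
Qed.

Lemma pres_repr u : pres_eq (repr (pi u)) u.
Proof. by apply/pres_piP; rewrite reprK. Qed.

Lemma letter_invK : involutive letter_inv.
Proof. by case=> x b; rewrite /letter_inv /= negbK. Qed.

Lemma word_inv_cat u v : word_inv (u ++ v) = word_inv v ++ word_inv u.
Proof. by rewrite /word_inv map_cat rev_cat. Qed.

Lemma word_invK : involutive word_inv.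
Proof. by move=> w; rewrite /word_inv map_rev revK mapK //; exact: letter_invK. Qed.

Lemma pres_eq_mulV w : pres_eq (w ++ word_inv w) [::].
Proof.
elim: w => [|l w IH]; first exact: pres_refl.
have -> : (l :: w) ++ word_inv (l :: w)
        = [:: l] ++ ((w ++ word_inv w) ++ [:: letter_inv l]).
  by rewrite /word_inv /= rev_cons -cats1 !catA.
apply: (pres_trans _ (pres_cancel l)).
apply: (@pres_cat [:: l] [:: l] _ [:: letter_inv l]); first exact: pres_refl.
exact: (pres_cat IH (pres_refl _)).
Qed.

Lemma pres_eq_inv u v : pres_eq u v -> pres_eq (word_inv u) (word_inv v).
Proof.
move=> uv.
apply: (@pres_trans (word_inv u ++ (v ++ word_inv v))).
  apply: pres_sym; rewrite -[X in pres_eq _ X]cats0.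
  exact: pres_cat (pres_refl _) (pres_eq_mulV v).
rewrite catA -[X in pres_eq _ X]cat0s; apply: pres_cat (pres_refl _).
apply: (@pres_trans (word_inv u ++ u)).
  exact: pres_cat (pres_refl _) (pres_sym uv).
by have := pres_eq_mulV (word_inv u); rewrite word_invK.
Qed.

Definition pres_mul (a b : pres_group) : pres_group := pi (repr a ++ repr b).
Definition pres_inv (a : pres_group) : pres_group := pi (word_inv (repr a)).
Definition pres_one : pres_group := pi [::].

Lemma pres_mul_pi u v : pres_mul (pi u) (pi v) = pi (u ++ v).
Proof. by apply/pres_piP/pres_cat; exact: pres_repr. Qed.

Lemma pres_inv_pi u : pres_inv (pi u) = pi (word_inv u).
Proof. exact/pres_piP/pres_eq_inv/pres_repr. Qed.

Lemma pres_surj a : exists u, a = pi u.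
Proof. by exists (repr a); rewrite reprK. Qed.

Lemma pres_mulA : associative pres_mul.
Proof.
move=> a b c.
have [[u ->] [v ->] [w ->]] := And3 (pres_surj a) (pres_surj b) (pres_surj c).
by rewrite !pres_mul_pi catA.
Qed.

Lemma pres_mul1 : left_id pres_one pres_mul.
Proof. by move=> a; have [u ->] := pres_surj a; rewrite pres_mul_pi. Qed.

Lemma pres_mulr1 : right_id pres_one pres_mul.
Proof. by move=> a; have [u ->] := pres_surj a; rewrite pres_mul_pi cats0. Qed.

Lemma pres_mulV : right_inverse pres_one pres_inv pres_mul.
Proof.
move=> a; have [u ->] := pres_surj a; rewrite pres_inv_pi pres_mul_pi.
exact/pres_piP/pres_eq_mulV.
Qed.

Lemma pres_mulVl : left_inverse pres_one pres_inv pres_mul.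
Proof.
move=> a; have [u ->] := pres_surj a; rewrite pres_inv_pi pres_mul_pi.
apply/pres_piP; have := pres_eq_mulV (word_inv u).
by rewrite word_invK.
Qed.

HB.instance Definition _ := isGroup.Build pres_group
  pres_mulA pres_mul1 pres_mulr1 pres_mulVl pres_mulV.

End Presentation.

Definition group_iso (G H : groupType) : Prop :=
  exists f : G -> H, bijective f /\ {morph f : x y / (x * y)%g}.

(* Homomorphisms from a group to the additive group of V. *)
Definition additive_char (G : groupType) (V : zmodType) (f : G -> V) : Prop :=
  {morph f : x y / (x * y)%g >-> x + y}.

Definition iso_Z2 (G : groupType) : Prop :=
  exists f : G -> int * int, bijective f /\ additive_char f.

Definition in_gen (G : groupType) (A : set G) (g : G) : Prop :=
  forall H : {pred G}, group_closed H -> (forall a, A a -> a \in H) -> g \in H.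

Definition generates (G : groupType) (S : seq G) : Prop :=
  forall g : G, in_gen [set s | s \in S] g.

Definition in_derived (G : groupType) (g : G) : Prop :=
  in_gen [set c | exists x y : G, c = [~ x, y]%g] g.

Definition expgz (G : groupType) (x : G) (k : int) : G :=
  match k with
  | Posz n => (x ^+ n)%g
  | Negz n => (x ^- n.+1)%g
  end.

(* The images of the t i in H_1(G; Z) = G / [G, G] are linearly independent
   over Z. *)
Definition ab_independent (G : groupType) (n : nat) (t : 'I_n -> G) : Prop :=
  forall k : 'I_n -> int,
    in_derived (\prod_(i < n) expgz (t i) (k i))%g -> forall i, k i = 0.

(* b_1(G) = n, where b_1(G) is the rank of H_1(G; Z). *)
Definition first_betti (G : groupType) (n : nat) : Prop :=
  (exists t : 'I_n -> G, ab_independent t) /\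
  (forall t : 'I_n.+1 -> G, ~ ab_independent t).

Definition nice_21_presentation (r : word 'I_2) : Prop :=
  [/\ r != [::], cyclically_reduced r & first_betti (pres_group r) 2].

Definition admits_nice_21_presentation (G : groupType) : Prop :=
  exists r : word 'I_2, nice_21_presentation r /\ group_iso G (pres_group r).

Definition cayley_edge (G : groupType) (S : seq G) (g h : G) : bool :=
  has (fun s => (h == g * s)%g || (g == h * s)%g) S.

Section Reach.
Variables (T : eqType) (e : rel T).

Definition reach x y := exists p, path e x p /\ last x p = y.

Lemma reach_refl x : reach x x.
Proof. by exists [::]. Qed.

Lemma reach1 x y : e x y -> reach x y.
Proof. by move=> exy; exists [:: y]; rewrite /= exy. Qed.

Lemma reach_trans y x z : reach x y -> reach y z -> reach x z.
Proof.
move=> [p [pp pl]] [q [qp ql]]; exists (p ++ q).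
by rewrite cat_path pp last_cat pl.
Qed.

Lemma reach_sym x y : symmetric e -> reach x y -> reach y x.
Proof.
move=> eC [p [pp pl]]; exists (rev (belast x p)); split.
  by rewrite -pl rev_path; under eq_path do rewrite eC.
by case: p pp pl => [|z p] //= _ _; rewrite rev_cons last_rcons.
Qed.

End Reach.

Section Sigma.
Variables (R : realType) (G : groupType).
Implicit Types (phi psi : G -> R) (S T : seq G).

Definition nonzero_char : set (G -> R) :=
  [set phi | additive_char phi /\ exists g, phi g != 0].

(* The class of phi in S(G), as a subset of Hom(G, R). *)
Definition ray phi : set (G -> R) :=
  [set psi | exists2 c : R, 0 < c & forall g, psi g = c * phi g].

Definition char_sphere : set (set (G -> R)) :=
  [set ray phi | phi in nonzero_char].

(* Connectedness of the full subgraph of the Cayley graph on {phi <= 0}. *)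
Definition halfspace_connected S phi : Prop :=
  forall g h : G, phi g <= 0 -> phi h <= 0 ->
    exists p : seq G,
      [/\ path (cayley_edge S) g p, last g p = h &
          {in p, forall x, phi x <= 0}].

(* By [halfspace_connected_indep] below, the choice of the generating set S is
   immaterial. *)
Definition Sigma : set (set (G -> R)) :=
  [set ray phi | phi in [set phi | nonzero_char phi /\
     exists S, generates S /\ halfspace_connected S phi]].

Lemma additive_char1 phi : additive_char phi -> phi 1%g = 0.
Proof.
by move=> phiM; apply: (addrI (phi 1%g)); rewrite -phiM mulg1 addr0.
Qed.

Lemma additive_charV phi g : additive_char phi -> phi g^-1%g = - phi g.
Proof.
move=> phiM; apply: (addrI (phi g)).
by rewrite -phiM mulgV subrr additive_char1.
Qed.

Lemma additive_charX phi g n :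
  additive_char phi -> phi (g ^+ n)%g = phi g *+ n.
Proof.
move=> phiM; elim: n => [|n IH]; first by rewrite expg0 additive_char1.
by rewrite expgS phiM IH mulrS.
Qed.

Lemma cayley_edgeM S k g h :
  cayley_edge S (k * g)%g (k * h)%g = cayley_edge S g h.
Proof.
by apply: eq_has => s; rewrite -!mulgA !(inj_eq (mulgI k)).
Qed.

Lemma cayley_edgeC S : symmetric (cayley_edge S).
Proof. by move=> g h; apply: eq_has => s; rewrite orbC. Qed.

Lemma generates_reach S g h : generates S -> reach (cayley_edge S) g h.
Proof.
move=> genS; have eC := cayley_edgeC S.
have shift k x y :
    reach (cayley_edge S) x y -> reach (cayley_edge S) (k * x)%g (k * y)%g.
  move=> [p [pp pl]]; exists (map ( *%g k) p); split; last by rewrite last_map pl.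
  by rewrite path_map; apply: sub_path pp => u v /=; rewrite cayley_edgeM.
suff conn1 x : reach (cayley_edge S) 1%g x.
  by apply: reach_trans (conn1 h); exact: reach_sym.
have : x \in [pred x | `[< reach (cayley_edge S) 1%g x >]].
  apply: (genS x) => [|s /= sS].
    split; first exact/asboolP/reach_refl.
    move=> u v /asboolP cu /asboolP cv; apply/asboolP; apply: reach_trans cu _.
    rewrite -[X in reach _ X]mulg1; apply: (shift u).
    by apply: reach_sym => //; have := shift v^-1%g _ _ cv; rewrite mulg1 mulVg.
  by apply/asboolP/reach1/hasP; exists s => //; rewrite mul1g eqxx.
by move/asboolP.
Qed.

Definition halfspace_edge S phi : rel G :=
  fun x y => [&& cayley_edge S x y, phi x <= 0 & phi y <= 0].

Lemma halfspace_edgeC S phi : symmetric (halfspace_edge S phi).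
Proof. by move=> x y; rewrite /halfspace_edge cayley_edgeC [X in _ && X]andbC. Qed.

Lemma halfspace_path S phi g p : phi g <= 0 ->
  path (halfspace_edge S phi) g p =
  path (cayley_edge S) g p && all (fun x => phi x <= 0) p.
Proof.
elim: p g => [//|x p IH] g g0 /=; rewrite {1}/halfspace_edge g0 /=.
case: (cayley_edge S g x) => //=.
by have [x0|_] /= := boolP (phi x <= 0); [exact: IH | rewrite andbF].
Qed.

Lemma halfspace_connectedP S phi :
  halfspace_connected S phi <->
  forall g h, phi g <= 0 -> phi h <= 0 -> reach (halfspace_edge S phi) g h.
Proof.
split=> H g h g0 h0; have := H g h g0 h0.
  by move=> [p [pp pl /allP pn]]; exists p; rewrite halfspace_path ?pp.
move=> [p [pp pl]]; exists p.
by move: pp; rewrite halfspace_path // => /andP[pp /allP].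
Qed.

Lemma generates_neg T phi : nonzero_char phi -> generates T ->
  exists t, phi t < 0 /\ forall x, cayley_edge T x (x * t)%g.
Proof.
move=> [phiM [g /eqP g0]] gT.
have [s sT s0] : exists2 s, s \in T & phi s != 0.
  apply/hasP/negP => /negP/hasPn T0; apply: g0; apply/eqP.
  have : g \in [pred x | phi x == 0].
    apply: (gT g) => [|s /= /T0]; last by rewrite negbK.
    split; first by rewrite inE additive_char1.
    move=> x y; rewrite !inE => /eqP x0 /eqP y0.
    by rewrite phiM additive_charV // x0 y0 oppr0 addr0.
  by rewrite inE.
case: (ltgtP (phi s) 0) => [sn|sp|/eqP]; last by rewrite (negbTE s0).
  by exists s; split=> // x; apply/hasP; exists s; rewrite ?eqxx.
exists s^-1%g; split=> [|x]; first by rewrite additive_charV // oppr_lt0.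
by apply/hasP; exists s; rewrite // mulgVK eqxx orbT.
Qed.

Lemma generates_bound S T phi : generates T -> exists2 D : R, 0 <= D &
  {in S, forall s, exists p, [/\ path (cayley_edge T) 1%g p, last 1%g p = s
                             & {in p, forall x, phi x <= D}]}.
Proof.
move=> gT; elim: S => [|s S [D D0 IH]]; first by exists 0.
have [p [pp pl]] := generates_reach 1%g s gT.
have [M MP] : exists M, {in p, forall x, phi x <= M}.
  elim: {pp pl} p => [|x p [M MP]]; first by exists 0.
  exists (Num.max M (phi x)) => y; rewrite inE le_max => /predU1P[->|/MP ->//].
  by rewrite lexx orbT.
exists (Num.max D M) => [|u]; first by rewrite le_max D0.
rewrite inE => /predU1P[->|/IH[q [qp ql qD]]].
  by exists p; split=> // x /MP; rewrite le_max orbC => ->.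
by exists q; split=> // x /qD; rewrite le_max => ->.
Qed.

(* Push g and h down by a power of a generator t with phi t < 0, and replace
   each edge of an S-path by a T-path. *)
Lemma halfspace_connected_sub S T phi :
  nonzero_char phi -> generates S -> generates T ->
  halfspace_connected S phi -> halfspace_connected T phi.
Proof.
move=> phi0 gS gT /halfspace_connectedP HS; apply/halfspace_connectedP => g h g0 h0.
have [phiM _] := phi0; have eC := halfspace_edgeC T phi.
have [t [t0 tE]] := generates_neg phi0 gT.
have [D D0 DP] := generates_bound S phi gT.
have down n x : phi x <= 0 -> reach (halfspace_edge T phi) x (x * t ^+ n)%g.
  move=> x0; elim: n => [|n IH]; first by rewrite expg0 mulg1; exact: reach_refl.
  apply: (reach_trans IH); rewrite expgSr mulgA; apply: reach1.
  rewrite /halfspace_edge tE /=.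
  have xn : phi (x * t ^+ n)%g <= 0.
    by rewrite phiM additive_charX // -[leRHS]addr0 lerD // mulrn_wle0 // ltW.
  by rewrite xn phiM -[leRHS]addr0 lerD // ltW.
have edge x y : phi x <= - D -> phi y <= - D -> cayley_edge S x y ->
    reach (halfspace_edge T phi) x y.
  move=> xD yD /hasP[s sS]; have [p [pp pl pD]] := DP s sS.
  suff shift z : phi z <= - D -> reach (halfspace_edge T phi) z (z * s)%g.
    by case/orP=> /eqP E; [rewrite E | apply: reach_sym => //; rewrite E];
      apply: shift.
  move=> zD; exists (map ( *%g z) p); split; last first.
    by rewrite -[X in last X _]mulg1 last_map pl.
  rewrite halfspace_path; last by rewrite (le_trans zD) // oppr_le0.
  apply/andP; split.
    rewrite -[X in path _ X _]mulg1 path_map.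
    by apply: sub_path pp => u v /=; rewrite cayley_edgeM.
  apply/allP => _ /mapP[u /pD uD ->].
  by rewrite phiM -(addNr D) lerD.
have [n nD] : exists n, phi (t ^+ n)%g <= - D.
  exists (Num.bound (D / - phi t)); rewrite additive_charX //.
  rewrite lerNr -mulNrn -mulr_natl -ler_pdivrMr ?oppr_gt0 //.
  by apply/ltW/archi_boundP; rewrite divr_ge0 // oppr_ge0 ltW.
set a := (t ^+ n)%g in nD.
apply: reach_trans (down n g g0) _; rewrite -/a.
apply: reach_trans (reach_sym eC (down n h h0)); rewrite -/a.
have phiJ x : phi (a^-1 * x * a)%g = phi x.
  by rewrite !phiM additive_charV // addrAC addNr add0r.
have [|| p [pp pl]] := HS (a^-1 * g * a)%g (a^-1 * h * a)%g; rewrite ?phiJ //.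
have -> : (g * a = a * (a^-1 * g * a))%g by rewrite !mulgA mulgV mul1g.
have -> : (h * a = a * (a^-1 * h * a))%g by rewrite !mulgA mulgV mul1g.
elim: p (a^-1 * g * a)%g pp pl => [x _ <-|y p IH x]; first exact: reach_refl.
rewrite /= => /andP[/and3P[xy x0 y0] yp] l.
apply: reach_trans (IH y yp l); apply: edge; last by rewrite cayley_edgeM.
  by rewrite phiM -[leRHS]addr0 lerD.
by rewrite phiM -[leRHS]addr0 lerD.
Qed.

Lemma halfspace_connected_indep S T phi :
  nonzero_char phi -> generates S -> generates T ->
  halfspace_connected S phi <-> halfspace_connected T phi.
Proof. by move=> phi0 gS gT; split; apply: halfspace_connected_sub. Qed.

Lemma halfspace_connectedZ S phi c :
  0 < c -> halfspace_connected S (fun g => c * phi g) <->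
           halfspace_connected S phi.
Proof.
move=> c0; have E g : (c * phi g <= 0) = (phi g <= 0) by rewrite pmulr_rle0.
split=> H g h gl hl.
  have [||p [pp pl pn]] := H g h; rewrite ?E //.
  by exists p; split=> // x /pn; rewrite E.
rewrite !E in gl hl; have [p [pp pl pn]] := H g h gl hl.
by exists p; split=> // x /pn; rewrite E.
Qed.

Lemma SigmaP S phi : nonzero_char phi -> generates S ->
  Sigma (ray phi) <-> halfspace_connected S phi.
Proof.
move=> phi0 gS; split; last by move=> H; exists phi => //; split=> //; exists S.
move=> [psi [psi0 [T [gT H]]] E].
have : ray phi psi.
  by rewrite -E; exists 1 => // g; rewrite mul1r.
move=> [c c0 /funext psiE]; rewrite psiE in H psi0.
by apply: (halfspace_connected_sub phi0 gT gS); move/(halfspace_connectedZ T phi c0): H.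
Qed.

End Sigma.

Definition represents_Sigma (R : realType) (G : groupType) (phi : G -> int) :
  Prop := @Sigma R G (ray (fun g => (phi g)%:~R)).

(* Main.v *)
Require Import Defs.
From HB Require Import structures.
From mathcomp Require Import all_boot all_order all_algebra.
From mathcomp Require Import boolp classical_sets reals.
From mathcomp Require Import zify.

Set Implicit Arguments.
Unset Strict Implicit.
Unset Printing Implicit Defensive.

Import Order.TTheory GRing.Theory Num.Theory.
Local Open Scope ring_scope.

(** Since b_1 = 2, both exponent sums of the relator r vanish, so r is a closed
    walk in the plane and every integral phi = (p, q) is a homomorphism on the
    group.  If q is not 0, the kernel of phi maps to the group N with a generator
    x_i for each level i, the edges x of the walks, and with the lifts r_j of r to
    the levels j as relators: the edges y form a forest and are collapsed.  Suppose that the highest edge x_M occurs at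
    least twice in the lift r_0: the top of phi is heavy.  Then phi is not in the
    invariant.  Indeed a commutator of x and y lifts to x_M times the inverse of a
    lower generator, and a connected half-space would make it a product of lower
    generators, and x_M as well.  But the relators are staggered, each r_j having its own highest and lowest
    generator, so that by Magnus' Freiheitssatz N is a tower of
    amalgamated products, along free subgroups, of the one-relator groups of the
    r_j ([window_embed], [lower_meet]).  Hence x_M would already be a product of
    the other generators in the one-relator group of r_0, and this is impossible
    for a generator occurring twice in a cyclically reduced relator
    ([top_not_generated]).

    That last fact and the Freiheitssatz are proved together by Magnus' induction
    on the length of the relator ([magnus]): the lift of r to a suitable infinite
    cyclic covering is shorter than r, and the tower recovers the statement for r
    from the statement for its lifts.  The only combinatorial group theory needed
    is the fact that amalgamated products contain their factors and that these
    meet in the amalgamated subgroup ([amalgam]); it is proved by letting both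
    factors act on one set.

    Conversely, suppose that no direction has a heavy top ([light_commutator]).  A
    direction with p and q non-zero then has a unique highest point on the walk,
    which forces the walk to pass through the corners of its bounding box.  In the
    directions of the axes, each side of the box contains a single edge of the
    walk; as this edge joins two corners, the box is a unit square.  So r is a
    commutator of the generators or their inverses, and the group is Z^2. *)

(** * Presentations with several relators *)

Section Relators.
Variable X : choiceType.
Implicit Types (u v w : word X) (l : letter X) (R : word X -> Prop).

(** The relation [pres_eq r] for a whole set R of relators.  The kernel of a
    homomorphism to the integers has infinitely many relators, the translates
    of r, and the argument compares subsets of them. *)
Inductive rel_eq R : word X -> word X -> Prop :=
| rel_refl w : rel_eq R w w
| rel_sym u v : rel_eq R u v -> rel_eq R v u
| rel_trans v u w : rel_eq R u v -> rel_eq R v w -> rel_eq R u w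
| rel_cat u u' v v' : rel_eq R u u' -> rel_eq R v v' ->
    rel_eq R (u ++ v) (u' ++ v')
| rel_cancel l : rel_eq R [:: l; letter_inv l] [::]
| rel_rel w : R w -> rel_eq R w [::].

Lemma rel_eq_sub R R' u v : (forall w, R w -> rel_eq R' w [::]) ->
  rel_eq R u v -> rel_eq R' u v.
Proof.
move=> sRR'; elim=> {u v} [w|u v _|v u w _ IH1 _|u u' v v' _ IH1 _ IH2|l|w /sRR' //].
- exact: rel_refl.
- exact: rel_sym.
- exact: rel_trans.
- exact: rel_cat.
- exact: rel_cancel.
Qed.

(** As the empty relator is trivial, [pres_eq [::]] is equality in the free
    group. *)
Lemma free_rel_eq R u v : pres_eq [::] u v -> rel_eq R u v.
Proof.
elim=> {u v} [w|u v _|v u w _ IH1 _|u u' v v' _ IH1 _ IH2|l|].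
- exact: rel_refl.
- exact: rel_sym.
- exact: rel_trans.
- exact: rel_cat.
- exact: rel_cancel.
- exact: rel_refl.
Qed.

Lemma pres_rel_eq r u v : pres_eq r u v <-> rel_eq (eq r) u v.
Proof.
split; elim=> {u v} [w|u v _|v u w _ IH1 _|u u' v v' _ IH1 _ IH2|l|].
- exact: rel_refl.
- exact: rel_sym.
- exact: rel_trans.
- exact: rel_cat.
- exact: rel_cancel.
- exact: rel_rel.
- exact: pres_refl.
- exact: pres_sym.
- exact: pres_trans.
- exact: pres_cat.
- exact: pres_cancel.
- by move=> _ <-; exact: pres_rel.
Qed.

Lemma rel_catl R w u v : rel_eq R u v -> rel_eq R (w ++ u) (w ++ v).
Proof. exact/rel_cat/rel_refl. Qed.

Lemma rel_catr R w u v : rel_eq R u v -> rel_eq R (u ++ w) (v ++ w).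
Proof. by move=> uv; apply: rel_cat uv (rel_refl _ _). Qed.

Lemma rel_mulV R w : rel_eq R (w ++ word_inv w) [::].
Proof. exact/free_rel_eq/pres_eq_mulV. Qed.

Lemma rel_mulVl R w : rel_eq R (word_inv w ++ w) [::].
Proof. by have := rel_mulV R (word_inv w); rewrite word_invK. Qed.

Lemma rel_mulKr R u v : rel_eq R (u ++ word_inv v ++ v) u.
Proof. by rewrite -[X in rel_eq R _ X]cats0; apply/rel_catl/rel_mulVl. Qed.

Lemma rel_mulKVr R u v : rel_eq R (u ++ v ++ word_inv v) u.
Proof. by rewrite -[X in rel_eq R _ X]cats0; apply/rel_catl/rel_mulV. Qed.

Lemma rel_divP R u v : rel_eq R u v <-> rel_eq R (u ++ word_inv v) [::].
Proof.
split=> [uv|uv].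
  exact: rel_trans (rel_catr (word_inv v) uv) (rel_mulV _ _).
apply: rel_trans (rel_sym (rel_mulKr R u v)) _; rewrite catA.
exact: (rel_catr v uv).
Qed.

Lemma rel_cancelr R w u v : rel_eq R (u ++ w) (v ++ w) -> rel_eq R u v.
Proof.
move=> /(rel_catr (word_inv w)); rewrite -!catA => uv.
exact: rel_trans (rel_sym (rel_mulKVr R u w)) (rel_trans uv (rel_mulKVr R v w)).
Qed.

Definition over (Y : pred X) w := all (fun l => Y l.1) w.

Lemma over_cat Y u v : over Y (u ++ v) = over Y u && over Y v.
Proof. exact: all_cat. Qed.

Lemma over_inv Y w : over Y (word_inv w) = over Y w.
Proof. by rewrite /over /word_inv all_rev all_map; apply: eq_all. Qed.

Lemma sub_over (Y Y' : pred X) w : {subset Y <= Y'} -> over Y w -> over Y' w.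
Proof. by move=> sY; apply: sub_all => l; apply: sY. Qed.

Definition lwt (f : X -> int) l : int := if l.2 then - f l.1 else f l.1.
(** The homomorphism from the free group to the integers with value f x on the
    generator x. *)
Definition wt (f : X -> int) w : int := \sum_(l <- w) lwt f l.

Lemma wt_nil f : wt f [::] = 0.
Proof. exact: big_nil. Qed.
Lemma wt_cons f l w : wt f (l :: w) = lwt f l + wt f w.
Proof. exact: big_cons. Qed.
Lemma wt_cat f u v : wt f (u ++ v) = wt f u + wt f v.
Proof. exact: big_cat. Qed.
Lemma lwt_inv f l : lwt f (letter_inv l) = - lwt f l.
Proof. by case: l => y [] //=; rewrite /lwt /= opprK. Qed.
Lemma wt_inv f w : wt f (word_inv w) = - wt f w.
Proof.
rewrite /wt /word_inv -sumrN (perm_big (map (@letter_inv _) w)) ?perm_rev //=.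
by rewrite big_map; apply: eq_bigr => l _; rewrite lwt_inv.
Qed.

(** The integer k is the signed number of uses of r in a derivation of u = v,
    hence serves all the homomorphisms at once; this controls exponent sums
    even when that of r is not zero. *)
Lemma wt_rel_eq r u v : rel_eq (eq r) u v ->
  exists k : int, forall f, wt f u = wt f v + k * wt f r.
Proof.
elim=> {u v} [w|u v _ [k E]|v u w _ [k E] _ [k' E']|u u' v v' _ [k E] _ [k' E']|l|_ <-].
- by exists 0 => f; rewrite mul0r addr0.
- by exists (- k) => f; rewrite E mulNr addrK.
- by exists (k + k') => f; rewrite E E' mulrDl -addrA; congr (_ + _); exact: addrC.
- by exists (k + k') => f; rewrite !wt_cat E E' mulrDl addrACA.
- by exists 0 => f; rewrite !wt_cons wt_nil lwt_inv; lia.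
- by exists 1 => f; rewrite wt_nil; lia.
Qed.

Lemma wt_free u v f : pres_eq [::] u v -> wt f u = wt f v.
Proof.
move/pres_rel_eq/wt_rel_eq => [k ->]; by rewrite wt_nil mulr0 addr0.
Qed.

Definition nocancel l m : bool := m != letter_inv l.
Definition reduced w := sorted nocancel w.
(** Doubling turns cyclic reducedness into plain reducedness, which is what
    survives lifting to a covering. *)
Definition cycred w := reduced (w ++ w).

Lemma cycredP w : cyclically_reduced w -> cycred w.
Proof.
case: w => [//|l w]; rewrite /cyclically_reduced /cycred /reduced /= => c.
rewrite -cat_rcons cat_path c last_rcons /=.
by move: c; rewrite rcons_path => /andP[].
Qed.

Definition rcancel l w :=
  if w is m :: w' then if m == letter_inv l then w' else l :: w else [:: l].
Definition red w := foldr rcancel [::] w.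

Lemma rcancel_reduced l w : reduced w -> reduced (rcancel l w).
Proof.
case: w => [//|m w] /= mw; case: ifPn => [_|nc]; first exact: path_sorted mw.
by rewrite /reduced /= /nocancel nc.
Qed.

Lemma red_reduced w : reduced (red w).
Proof. by elim: w => // l w IH; exact: rcancel_reduced. Qed.

(** Each letter acts on the set of reduced words by a permutation, so that the
    free group acts there: this is why [red] is an invariant of [pres_eq [::]]. *)
Lemma rcancelK l w : reduced w -> rcancel l (rcancel (letter_inv l) w) = w.
Proof.
case: w => [|m w] /=; first by rewrite eqxx.
rewrite letter_invK; case: eqVneq => [-> |nc _].
  case: w => [//|k w] /=; rewrite {1}/nocancel => /andP[nc _].
  by rewrite (negbTE nc).
by rewrite /= eqxx.
Qed.

Lemma foldr_rcancel_reduced u w : reduced w -> reduced (foldr rcancel w u).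
Proof. by move=> rw; elim: u => //= l u; exact: rcancel_reduced. Qed.

Lemma red_free u v : pres_eq [::] u v -> red u = red v.
Proof.
suff H : pres_eq [::] u v ->
    forall w, reduced w -> foldr rcancel w u = foldr rcancel w v.
  by move=> uv; exact: H.
elim=> {u v} // [u v _ IH w rw|v u w _ IH1 _ IH2 k rk|u u' v v' _ IH1 _ IH2 w rw|l w rw].
- by rewrite IH.
- by rewrite IH1 ?IH2.
- by rewrite !foldr_cat IH2 // IH1 // foldr_rcancel_reduced.
- by rewrite /= rcancelK.
Qed.

Lemma free_red w : pres_eq [::] w (red w).
Proof.
elim: w => [|l w IH]; first exact: pres_refl.
have lw : pres_eq [::] (l :: w) (l :: red w).
  exact: (@pres_cat _ _ [:: l] [:: l] _ _ (pres_refl _ _) IH).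
apply: pres_trans lw _; rewrite /= /rcancel.
case: (red w) => [|m v]; first exact: pres_refl.
case: eqP => [->|_]; last exact: pres_refl.
exact: (@pres_cat _ _ [:: l; letter_inv l] [::] v v (pres_cancel _ _) (pres_refl _ _)).
Qed.

Lemma red_id w : reduced w -> red w = w.
Proof.
elim: w => // l w IH lw; rewrite /= IH; last exact: path_sorted lw.
by case: w lw {IH} => // m w /andP[nc _]; rewrite /= (negbTE nc).
Qed.

Lemma reduced_nontrivial w : reduced w -> pres_eq [::] w [::] -> w = [::].
Proof. by move=> rw /red_free; rewrite red_id. Qed.

Lemma red_sub w : {subset red w <= w}.
Proof.
elim: w => // l w IH m; rewrite inE /= => mw.
have : m \in l :: red w.
  move: mw; rewrite /rcancel; case: (red w) => [//|k v].
  by case: ifP => // _ mv; rewrite !inE mv !orbT.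
by rewrite inE => /predU1P[->|/IH ->]; rewrite ?eqxx ?orbT.
Qed.

Lemma over_red Y w : over Y w -> over Y (red w).
Proof. by move=> /allP Yw; apply/allP => l /red_sub /Yw. Qed.

End Relators.

(** * Amalgamated products by permutations *)

Section Cosets.
Variables (X : choiceType) (C : pred X).
Implicit Types (R : word X -> Prop) (u v w c g : word X).

(** Modulo R, every word g is [coset_pos R g ++ coset_rep R g], with the first
    factor a word over C and the second a chosen representative of the coset
    C g.  The representative depends on the coset only, so that equality of
    cosets is equality of words. *)
Definition coset_rep R g : word X :=
  xget [::] [set v | exists2 c, over C c & rel_eq R g (c ++ v)].

Definition coset_pos R g : word X :=
  xget [::] [set c | over C c /\ rel_eq R g (c ++ coset_rep R g)].

Lemma coset_posP R g :
  over C (coset_pos R g) /\ rel_eq R g (coset_pos R g ++ coset_rep R g).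
Proof.
rewrite /coset_pos; case: xgetP => [c _ [] //|no].
have : [set v | exists2 c, over C c & rel_eq R g (c ++ v)]%classic (coset_rep R g).
  rewrite /coset_rep; case: xgetP => [v _ //|/(_ g) []].
  by exists [::] => //; exact: rel_refl.
by case=> c Cc gc; case: (no c).
Qed.

Lemma over_pos R g : over C (coset_pos R g).
Proof. by have [] := coset_posP R g. Qed.

Lemma pos_rep R g : rel_eq R g (coset_pos R g ++ coset_rep R g).
Proof. by have [] := coset_posP R g. Qed.

Lemma coset_rep_eq R c g g' : over C c -> rel_eq R g (c ++ g') ->
  coset_rep R g = coset_rep R g'.
Proof.
move=> Cc gg'; rewrite /coset_rep; congr xget; apply/seteqP; split=> v /= [d Cd dE].
  exists (word_inv c ++ d); first by rewrite over_cat over_inv Cc.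
  rewrite -catA; apply: rel_trans (rel_catl (word_inv c) dE).
  apply: rel_trans (rel_catl (word_inv c) (rel_sym gg')); rewrite catA.
  exact/rel_sym/(rel_catr g' (rel_mulVl R c)).
exists (c ++ d); first by rewrite over_cat Cc.
by rewrite -catA; apply: rel_trans gg' (rel_catl c dE).
Qed.

Lemma coset_rep_cat R c g : over C c -> coset_rep R (c ++ g) = coset_rep R g.
Proof. by move=> Cc; apply: (coset_rep_eq Cc); exact: rel_refl. Qed.

Lemma coset_repK R g : coset_rep R (coset_rep R g) = coset_rep R g.
Proof. exact/esym/(coset_rep_eq (over_pos R g) (pos_rep R g)). Qed.

Lemma coset_pos_cat R c g g' : over C c -> rel_eq R g (c ++ g') ->
  rel_eq R (coset_pos R g) (c ++ coset_pos R g').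
Proof.
move=> Cc gg'; apply: (@rel_cancelr _ _ (coset_rep R g)).
apply: rel_trans (rel_sym (pos_rep R g)) _; apply: (rel_trans gg').
by rewrite -catA (coset_rep_eq Cc gg'); exact/rel_catl/pos_rep.
Qed.

Lemma coset_pos_rep R g : rel_eq R (coset_pos R (coset_rep R g)) [::].
Proof.
apply: (@rel_cancelr _ _ (coset_rep R g)).
by apply: rel_sym; have := pos_rep R (coset_rep R g); rewrite coset_repK.
Qed.

End Cosets.

(** Two groups <X | R> and <X | S> with a common subgroup generated by C.  Write
    an element of the first as c t and one of the second as c t' with c in the
    subgroup and t, t' coset representatives.  A pair of words is matched when
    both entries have the same c: matched pairs stand for triples (c, t, t').
    The first group acts on them by left multiplication of c t, keeping t', the
    second by left multiplication of c t', keeping t, and on the common subgroup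
    both actions are left multiplication of c.  Hence the two actions glue to an
    action of the amalgamated product, with no normal forms. *)
Section Side.
Variables (X : choiceType) (C : pred X) (R S : word X -> Prop).
Hypothesis agree : forall c, over C c -> rel_eq R c [::] <-> rel_eq S c [::].
Implicit Types (u v w c g : word X) (p q : word X * word X).

Notation pos T := (coset_pos C T).
Notation rep T := (coset_rep C T).

Lemma agreeP c d : over C c -> over C d -> rel_eq R c d <-> rel_eq S c d.
Proof.
move=> Cc Cd; have Ccd : over C (c ++ word_inv d) by rewrite over_cat over_inv Cc.
exact: iff_trans (rel_divP _ _ _) (iff_trans (agree Ccd) (iff_sym (rel_divP _ _ _))).
Qed.

Definition pair_eq p q := rel_eq R p.1 q.1 /\ rel_eq S p.2 q.2.
Definition matched p := rel_eq R (pos R p.1) (pos S p.2).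
(** The action of the first group: the second entry keeps its representative and
    receives the new common factor. *)
Definition push w p := (w ++ p.1, pos R (w ++ p.1) ++ rep S p.2).

Lemma pair_refl p : pair_eq p p.
Proof. by split; exact: rel_refl. Qed.
Lemma pair_sym p q : pair_eq p q -> pair_eq q p.
Proof. by case=> ? ?; split; exact: rel_sym. Qed.
Lemma pair_trans q p s : pair_eq p q -> pair_eq q s -> pair_eq p s.
Proof. by move=> [? ?] [? ?]; split; apply: rel_trans; eassumption. Qed.

Lemma push_matched w p : matched (push w p).
Proof.
rewrite /matched /=; set c := pos R _.
have Cc : over C c by exact: over_pos.
apply/agreeP; [exact: over_pos | exact: over_pos |].
apply: rel_sym; apply: rel_trans (coset_pos_cat Cc (rel_refl _ _)) _.
by rewrite -[X in rel_eq _ _ X]cats0; exact/rel_catl/coset_pos_rep.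
Qed.

Lemma push_eq u v p q : pair_eq p q -> rel_eq R u v ->
  pair_eq (push u p) (push v q).
Proof.
move=> [p1 p2] uv; split=> /=; first exact: rel_cat.
rewrite (@coset_rep_eq _ C S [::] p.2 q.2) //; apply: rel_catr.
apply/agreeP; [exact: over_pos | exact: over_pos |].
exact: (@coset_pos_cat _ C R [::] _ _ isT (rel_cat uv p1)).
Qed.

Lemma push_nil p : matched p -> pair_eq (push [::] p) p.
Proof.
move=> pm; split=> /=; first exact: rel_refl.
apply: rel_trans (rel_sym (pos_rep C S p.2)); apply: rel_catr.
by apply/agreeP => //; exact: over_pos.
Qed.

Lemma push_cat u v p : push (u ++ v) p = push u (push v p).
Proof.
by rewrite /push /= catA (coset_rep_cat _ _ (over_pos C R _)) coset_repK.
Qed.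

Lemma push_common c p : over C c -> matched p ->
  pair_eq (push c p) (c ++ p.1, c ++ p.2).
Proof.
move=> Cc pm; split=> /=; first exact: rel_refl.
apply: (@rel_trans _ _ ((c ++ pos S p.2) ++ rep S p.2)).
  apply/rel_catr/agreeP; rewrite ?over_cat ?Cc ?over_pos //.
  apply: rel_trans (coset_pos_cat Cc (rel_refl _ _)) _.
  exact: rel_catl.
by rewrite -catA; exact/rel_catl/rel_sym/pos_rep.
Qed.

End Side.

Section Amalgam.
Variables (X : choiceType) (Y0 Y1 : pred X) (R0 R1 : word X -> Prop).
Let C := predI Y0 Y1.
Hypothesis cover : forall z, Y0 z || Y1 z.
Hypothesis R0Y : forall w, R0 w -> over Y0 w.
Hypothesis R1Y : forall w, R1 w -> over Y1 w.
Hypothesis agree : forall c, over C c -> rel_eq R0 c [::] <-> rel_eq R1 c [::].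
Implicit Types (u v w c g : word X) (p q : word X * word X).

Let agree' c : over C c -> rel_eq R1 c [::] <-> rel_eq R0 c [::].
Proof. by move=> Cc; apply: iff_sym; exact: agree. Qed.

Let flip p := (p.2, p.1).
Let push0 := push C R0 R1.
Let push1 w p := flip (push C R1 R0 w (flip p)).
Let eqp := pair_eq R0 R1.
Let ok := matched C R0 R1.

Let ok_flip p : ok p <-> matched C R1 R0 (flip p).
Proof.
split=> /= pm; apply: rel_sym.
  by apply/(agreeP agree); first exact: over_pos; first exact: over_pos.
by apply/(agreeP agree); first exact: over_pos; first exact: over_pos.
Qed.

Let eq_flip p q : eqp p q <-> pair_eq R1 R0 (flip p) (flip q).
Proof. by split; case. Qed.

Let push1_ok w p : ok (push1 w p).
Proof. exact/ok_flip/(push_matched agree'). Qed.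

Let push1_eq u v p q : eqp p q -> rel_eq R1 u v -> eqp (push1 u p) (push1 v q).
Proof. by move=> /eq_flip pq uv; apply/eq_flip/(push_eq agree'). Qed.

Let push1_nil p : ok p -> eqp (push1 [::] p) p.
Proof. by move=> /ok_flip pm; apply/eq_flip/(push_nil agree'). Qed.

Let push1_cat u v p : push1 (u ++ v) p = push1 u (push1 v p).
Proof. by rewrite /push1 push_cat. Qed.

Let act l p := if Y0 l.1 then push0 [:: l] p else push1 [:: l] p.
Let acts u p := foldr act p u.

Let push01 w p : over C w -> ok p -> eqp (push0 w p) (push1 w p).
Proof.
move=> Cw pm; apply: pair_trans (push_common agree Cw pm) _.
by apply/pair_sym/eq_flip/(push_common agree' Cw)/ok_flip.
Qed.

Let acts_ok u p : ok p -> ok (acts u p).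
Proof.
case: u => [//|l u] _ /=; rewrite {1}/act; case: (Y0 l.1); last exact: push1_ok.
exact: (push_matched agree).
Qed.

Let acts_eq u p q : eqp p q -> eqp (acts u p) (acts u q).
Proof.
move=> pq; elim: u => //= l u IH; rewrite /act; case: (Y0 l.1).
  exact: (push_eq agree IH (rel_refl _ _)).
exact: (push1_eq IH (rel_refl _ _)).
Qed.

Let acts0 u p : over Y0 u -> ok p -> eqp (acts u p) (push0 u p).
Proof.
move=> + pm; elim: u => [_|l u IH /= /andP[Yl /IH up]].
  exact/pair_sym/(push_nil agree).
rewrite /= {1}/act Yl -[l :: u]cat1s /push0 push_cat.
exact: (push_eq agree up (rel_refl _ _)).
Qed.

Let acts1 u p : over Y1 u -> ok p -> eqp (acts u p) (push1 u p).
Proof.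
move=> + pm; elim: u => [_|l u IH /= /andP[Yl /IH up]].
  exact/pair_sym/push1_nil.
rewrite /= {1}/act -[l :: u]cat1s push1_cat;
  apply: (@pair_trans _ _ _ (push1 [:: l] (acts u p))).
  case: ifP => [Y0l|_]; last exact: pair_refl.
  by apply: push01; [rewrite /over /= Yl Y0l | exact: acts_ok].
exact: (push1_eq up (rel_refl _ _)).
Qed.

Let acts_sound u v p : rel_eq (fun w => R0 w \/ R1 w) u v ->
  ok p -> eqp (acts u p) (acts v p).
Proof.
have step0 w : over Y0 w -> rel_eq R0 w [::] -> forall q, ok q -> eqp (acts w q) q.
  move=> Yw w1 q qm; apply: pair_trans (acts0 Yw qm) _.
  apply: pair_trans (push_nil agree qm).
  exact: (push_eq agree (pair_refl _ _ _) w1).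
have step1 w : over Y1 w -> rel_eq R1 w [::] -> forall q, ok q -> eqp (acts w q) q.
  move=> Yw w1 q qm; apply: pair_trans (acts1 Yw qm) _.
  apply: pair_trans (push1_nil qm).
  exact: (push1_eq (pair_refl _ _ _) w1).
move=> uv; elim: uv p => {u v} [w|u v _ IH|v u w _ IH1 _ IH2|u u' v v' _ IH1 _ IH2|l|
  w Rw] p pm.
- exact: pair_refl.
- exact/pair_sym/IH.
- exact: pair_trans (IH1 p pm) (IH2 p pm).
- rewrite /acts !foldr_cat -!/(acts _ _).
  apply: (@pair_trans _ _ _ (acts u (acts v' p))); first exact/acts_eq/IH2.
  exact/IH1/acts_ok.
- have [Yl|Yl] := orP (cover l.1).
    by apply: step0 pm; [rewrite /over /= Yl | exact: rel_cancel].
  by apply: step1 pm; [rewrite /over /= Yl | exact: rel_cancel].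
- case: Rw => Rw; first by apply: step0 pm; [exact: R0Y | exact: rel_rel].
  by apply: step1 pm; [exact: R1Y | exact: rel_rel].
Qed.

(** The amalgamation theorem, for words: in the group with both sets of
    relators, the subgroups generated by Y0 and by Y1 meet only in the subgroup
    generated by their intersection, and no collapse takes place inside either
    of them.  Apply u and v to the pair of trivial cosets: u leaves the second
    representative in place and v the first, so the common result is a word
    over C. *)
Theorem amalgam u v : over Y0 u -> over Y1 v ->
  rel_eq (fun w => R0 w \/ R1 w) u v ->
  exists c, [/\ over C c, rel_eq R0 u c & rel_eq R1 v c].
Proof.
move=> Yu Yv uv; set t0 := coset_rep C R0 [::]; set t1 := coset_rep C R1 [::].
have pm : ok (t0, t1).
  rewrite /ok /matched /=; apply: (rel_trans (coset_pos_rep C R0 _)).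
  exact/rel_sym/(agree (over_pos _ _ _))/coset_pos_rep.
have E : eqp (push0 u (t0, t1)) (push1 v (t0, t1)).
  apply: pair_trans (pair_sym (acts0 Yu pm)) _.
  exact: pair_trans (acts_sound uv pm) (acts1 Yv pm).
case: E => /= E0 E1; set c := coset_pos C R1 _ in E0.
have Cc : over C c by exact: over_pos.
have uc : rel_eq R0 u c.
  by move: E0; rewrite /t0 coset_repK; exact: rel_cancelr.
exists c; split=> //.
have : rel_eq R1 (coset_pos C R0 (u ++ t0)) v.
  by move: E1; rewrite /t1 coset_repK; exact: rel_cancelr.
move/rel_sym/rel_trans; apply.
apply/(agreeP agree); rewrite ?over_pos //.
apply: rel_trans (coset_pos_cat Cc (rel_catr t0 uc)) _.
by rewrite -[X in rel_eq _ _ X]cats0; exact/rel_catl/coset_pos_rep.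
Qed.

End Amalgam.

(** * Lifts to an infinite cyclic covering *)

(** A map phi : X -> int sends a word to a walk on the integers, and the kernel of
    phi on the free group is the fundamental group of each component of the
    graph with an edge (x, i) from i to i + phi x for each generator x and level
    i.  When phi b is not 0 the edges (b, i) form a forest, and collapsing it
    erases the letters b without changing that group; identifying the remaining
    vertices only adds a free factor.  A word starting at level i thus becomes a
    word in the generators (x, j) with x different from b, shorter than the
    original if b occurs. *)
Section Lift.
Variables (X : choiceType) (phi : X -> int) (b : X).
Implicit Types (u v r : word X) (l : letter X) (i j : int).

(** An edge is named by its start, so that a backward letter leaving level i
    bears the level at which it arrives. *)
Definition edge i l : letter (X * int)%type :=
  ((l.1, if l.2 then i + lwt phi l else i), l.2).

Fixpoint lift_all i u : word (X * int)%type :=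
  if u is l :: u' then edge i l :: lift_all (i + lwt phi l) u' else [::].

Definition lift_word i u := [seq l <- lift_all i u | l.1.1 != b].

Lemma lift_all_cat i u v :
  lift_all i (u ++ v) = lift_all i u ++ lift_all (i + wt phi u) v.
Proof.
elim: u i => [|l u IH] i /=; first by rewrite wt_nil addr0.
by rewrite IH wt_cons addrA.
Qed.

Lemma lift_cat i u v : lift_word i (u ++ v) = lift_word i u ++ lift_word (i + wt phi u) v.
Proof. by rewrite /lift_word lift_all_cat filter_cat. Qed.

Lemma lift_cons i l u : lift_word i (l :: u) =
  (if l.1 != b then [:: edge i l] else [::]) ++ lift_word (i + lwt phi l) u.
Proof. by rewrite /lift_word /=; case: ifP. Qed.

Definition unlift (m : letter (X * int)%type) : letter X := (m.1.1, m.2).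

Lemma lift_fst i u : map unlift (lift_word i u) = [seq l <- u | l.1 != b].
Proof.
elim: u i => [//|l u IH] i; rewrite lift_cons map_cat IH /=.
by case: ifP => //= _; case: l.
Qed.

Lemma size_lift i u : size (lift_word i u) = count (fun l => l.1 != b) u.
Proof. by rewrite -(size_map unlift) lift_fst size_filter. Qed.

Lemma size_lift_lt i u : has (fun l => l.1 == b) u -> (size (lift_word i u) < size u)%N.
Proof.
rewrite size_lift has_count -(count_predC (fun l => l.1 == b)) => h.
by rewrite -[X in (X < _)%N]add0n ltn_add2r.
Qed.

Lemma over_lift (Y : pred X) i u : over Y u -> over (fun z => Y z.1) (lift_word i u).
Proof.
move=> Yu; rewrite /over -(all_map unlift (fun l : letter X => Y l.1)) lift_fst.
by rewrite all_filter; apply: sub_all Yu => l Yl; apply/implyP.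
Qed.

Lemma has_lift a i u : a != b ->
  has (fun m : letter (X * int)%type => m.1.1 == a) (lift_word i u) = has (fun l => l.1 == a) u.
Proof.
move=> ab; rewrite -(has_map unlift (fun l : letter X => l.1 == a)) lift_fst.
rewrite has_filter -filter_predI -has_filter; apply: eq_has => l /=.
by case: eqVneq => // ->.
Qed.

Definition lifts r : word (X * int)%type -> Prop := fun w => exists i, w = lift_word i r.

(** Relations modulo r lift to relations modulo all the lifts of r, which are
    closed walks as phi kills r. *)
Lemma lift_rel_eq r u v : wt phi r = 0 -> rel_eq (eq r) u v ->
  wt phi u = wt phi v /\ forall i, rel_eq (lifts r) (lift_word i u) (lift_word i v).
Proof.
move=> r0; elim=> {u v} [w|u v _ [E H]|v u w _ [E H] _ [E' H']|
  u u' v v' _ [E H] _ [E' H']|l|_ <-].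
- by split=> // i; exact: rel_refl.
- by split=> // i; exact: rel_sym.
- by split=> [|i]; [rewrite E | exact: rel_trans (H i) (H' i)].
- split=> [|i]; first by rewrite !wt_cat E E'.
  by rewrite !lift_cat E; exact: rel_cat.
- rewrite !wt_cons wt_nil lwt_inv addr0 subrr; split=> // i.
  rewrite !lift_cons /lift_word /=; case: ifP => _; last exact: rel_refl.
  rewrite (_ : edge (i + _) _ = letter_inv (edge i l)); first exact: rel_cancel.
  case: l => y [] /=; rewrite /edge /letter_inv /lwt /=; congr (_, _, _); lia.
- by split=> [|i]; [rewrite wt_nil | apply: rel_rel; exists i].
Qed.

Definition end_level (m : letter (X * int)%type) : int :=
  if m.2 then m.1.2 else m.1.2 + phi m.1.1.

Lemma end_level_edge i l : end_level (edge i l) = i + lwt phi l.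
Proof. by case: l => y []. Qed.

Lemma edge_inv i l m : edge i l = letter_inv m -> end_level m = i.
Proof.
case: m l => [[y k] s] [z t] [-> <- ts]; rewrite /end_level /lwt /=.
by case: t s ts => [] [] //= _; lia.
Qed.

Definition avoids (m : letter (X * int)%type) (w : word (X * int)%type) :=
  if w is k :: _ then nocancel m k else true.

(** Erasing a run of b moves the walk away from the end of the preceding edge m,
    and only an edge starting there could cancel m. *)
Lemma lift_avoids i c m u : phi b != 0 -> reduced ((b, c) :: u) ->
  0 <= lwt phi (b, c) * (i - end_level m) -> avoids m (lift_word i ((b, c) :: u)).
Proof.
move=> b0; elim: u i => [|l u IH] i; first by rewrite /lift_word /= eqxx.
rewrite {1}/reduced /= => /andP[nc lu] ge0.
have c0 : lwt phi (b, c) != 0 by rewrite /lwt /=; case: (c); rewrite ?oppr_eq0.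
have gt0 : 0 < lwt phi (b, c) * (i + lwt phi (b, c) - end_level m).
  by rewrite addrAC mulrDr ltr_wpDl // lt_def sqr_ge0 mulf_neq0.
rewrite lift_cons eqxx /=.
case: (eqVneq l.1 b) => [lb|lb].
  have El : l = (b, c).
    case: l nc lb {lu IH} => y s nc /= E; rewrite {}E in nc *.
    by case: s c nc {gt0 ge0 c0} => [] []; rewrite /nocancel /letter_inv /= ?eqxx.
  by rewrite El; apply: IH; [rewrite -El | exact: ltW].
rewrite lift_cons lb /= /nocancel; apply/eqP => /edge_inv E.
by move: gt0; rewrite E subrr mulr0 ltxx.
Qed.

Lemma lift_reduced i u : phi b != 0 -> reduced u -> reduced (lift_word i u).
Proof.
move=> b0; elim: u i => [//|l u IH] i lu.
have ru := IH (i + lwt phi l) (path_sorted lu).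
rewrite lift_cons; case: (eqVneq l.1 b) => //= lb.
suff : avoids (edge i l) (lift_word (i + lwt phi l) u).
  by rewrite /reduced; move: ru; rewrite /reduced; case: (lift_word _ _) => //= k w -> ->.
case: u lu {IH ru} => [//|k u] /andP[nc ku].
case: (eqVneq k.1 b) => [kb|kb].
  case: k kb nc ku => y c /= -> _ ku.
  by apply: lift_avoids => //; rewrite end_level_edge subrr mulr0.
rewrite lift_cons kb /=; apply: contra nc => /eqP E; apply/eqP.
by case: k l E {lb kb ku} => [y s] [z t] [-> _ ->].
Qed.

Lemma lift_cycred i u : phi b != 0 -> wt phi u = 0 -> cycred u -> cycred (lift_word i u).
Proof. by move=> b0 u0 /(lift_reduced i b0); rewrite lift_cat u0 addr0. Qed.

Definition shift j (m : letter (X * int)%type) : letter (X * int)%type :=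
  ((m.1.1, m.1.2 + j), m.2).

Lemma lift_shift i j u : lift_word (i + j) u = map (shift j) (lift_word i u).
Proof.
elim: u i => [//|l u IH] i; rewrite !lift_cons map_cat -IH addrAC; congr (_ ++ _).
by case: ifP => // _; rewrite /edge /shift /=; case: l.2; rewrite // addrAC.
Qed.

Definition levels (x : X) (w : word (X * int)%type) := [seq m.1.2 | m <- w & m.1.1 == x].

Lemma levelsP x i w : (i \in levels x w) = has (fun m => m.1 == (x, i)) w.
Proof.
elim: w => [//|[[y k] s] w IH] /=; rewrite /levels /= xpair_eqE.
by case: eqP => //= _; rewrite inE eq_sym IH.
Qed.

End Lift.

Lemma seq_min_max (T : realDomainType) (s : seq T) : s != [::] ->
  exists m M, [/\ m \in s, M \in s & {in s, forall i, m <= i <= M}].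
Proof.
elim: s => [//|i s IH] _; case: (eqVneq s [::]) => [->|/IH [m [M [ms Ms H]]]].
  by exists i, i; rewrite inE eqxx; split=> // j; rewrite inE => /eqP->; rewrite lexx.
exists (Num.min i m), (Num.max i M); split.
- by rewrite inE; case: (leP i m); rewrite ?eqxx // ms orbT.
- by rewrite inE; case: (leP i M); rewrite ?eqxx // Ms orbT.
- move=> j; rewrite inE => /predU1P[->|/H]; first by rewrite ge_min le_max lexx.
  by rewrite ge_min le_max => /andP[-> ->]; rewrite !orbT.
Qed.

(** * Towers of one-relator groups *)

(** The relators rho j are staggered: rho j involves the generators (x, i) with i
    between m + j and M + j only, while the generators (z, i) with z different from
    x are unrestricted.  Thus rho (e + 1) adds just one generator,
    (x, M + e + 1), to those of the previous relators, and the old and the new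
    group share the subgroup generated by a window from which one end has been
    removed.  By the Freiheitssatz for both ends of the window that subgroup is
    free on both sides, so that each step is an amalgamated product. *)
Section Tower.
Variables (X : choiceType) (x : X) (rho : int -> word (X * int)%type) (m M : int).
Hypothesis mM : m <= M.
Implicit Types (u v c : word (X * int)%type) (s e j k : int).

Definition above lo : pred (X * int)%type := fun z => (z.1 != x) || (lo <= z.2).
Definition below hi : pred (X * int)%type := fun z => (z.1 != x) || (z.2 <= hi).
Definition window lo hi := predI (above lo) (below hi).

Hypothesis rho_window : forall j, over (window (m + j) (M + j)) (rho j).
Hypothesis rho_bot : forall j u, over (predC1 (x, m + j)) u ->
  rel_eq (eq (rho j)) u [::] -> pres_eq [::] u [::].
Hypothesis rho_top : forall j u, over (predC1 (x, M + j)) u ->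
  rel_eq (eq (rho j)) u [::] -> pres_eq [::] u [::].

Definition stretch s e : word (X * int)%type -> Prop :=
  fun w => exists2 j, s <= j <= e & w = rho j.

Definition windows_embed s e := forall k u, s <= k <= e ->
  over (window (m + k) (M + k)) u ->
  rel_eq (stretch s e) u [::] -> rel_eq (eq (rho k)) u [::].

Lemma window_above lo hi : {subset window lo hi <= above lo}.
Proof. by move=> z; rewrite unfold_in /= => /andP[]. Qed.

Lemma window_below lo hi : {subset window lo hi <= below hi}.
Proof. by move=> z; rewrite unfold_in /= => /andP[]. Qed.

(** The subgroup over which the next relator is amalgamated is free on both
    sides: it omits the top generator of rho (e + 1) and the bottom generator of
    rho e, whose one-relator group embeds in the tower. *)
Lemma window_agree s e : s - 1 <= e -> windows_embed s e ->
  forall c, over (predI (below (M + e)) (above (m + e + 1))) c ->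
  rel_eq (stretch s e) c [::] <-> rel_eq (eq (rho (e + 1))) c [::].
Proof.
move=> se emb c Cc.
have noM : over (predC1 (x, M + (e + 1))) c.
  apply: sub_over Cc => -[z i]; rewrite !unfold_in /= xpair_eqE /below /above /=.
  by case: eqP => //= _ /andP[? ?]; apply/eqP; lia.
have nom : over (predC1 (x, m + e)) c.
  apply: sub_over Cc => -[z i]; rewrite !unfold_in /= xpair_eqE /below /above /=.
  by case: eqP => //= _ /andP[? ?]; apply/eqP; lia.
split=> c1; last exact/free_rel_eq/(rho_top noM).
apply: free_rel_eq; case: (lerP s e) => [le_se|lt_es].
  apply: (rho_bot nom); apply: emb c1; first by rewrite le_se lexx.
  apply: sub_over Cc => -[z i]; rewrite !unfold_in /= /below /above /=.
  by case: eqP => //= _ /andP[? ?]; apply/andP; split; lia.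
apply/(pres_rel_eq [::])/(rel_eq_sub _ c1) => w [j /andP[? ?]]; lia.
Qed.

Lemma stretch_amalgam s e u v : s - 1 <= e -> windows_embed s e ->
  over (below (M + e)) u -> over (above (m + e + 1)) v ->
  rel_eq (stretch s (e + 1)) u v ->
  exists c, [/\ over (predI (below (M + e)) (above (m + e + 1))) c,
                rel_eq (stretch s e) u c & rel_eq (eq (rho (e + 1))) v c].
Proof.
move=> se emb Yu Yv uv; apply: amalgam => //.
- by move=> [z i]; rewrite /below /above /=; case: eqP => //= _; lia.
- move=> w [j /andP[sj je] ->]; apply: sub_over (rho_window j) => z /window_below.
  by rewrite !unfold_in /below; case: eqP => //= _; lia.
- move=> w <-; apply: sub_over (rho_window _) => z /window_above.
  by rewrite !unfold_in /above; case: eqP => //= _; lia.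
- exact: window_agree.
- apply: rel_eq_sub uv => w [j /andP[sj je] ->]; apply: rel_rel.
  have [->|jne] := eqVneq j (e + 1); first by right.
  by left; exists j => //; apply/andP; split => //; lia.
Qed.

Lemma stretch_below s e u v : s - 1 <= e -> windows_embed s e ->
  over (below (M + e)) u -> over (below (M + e)) v ->
  rel_eq (stretch s (e + 1)) u v -> rel_eq (stretch s e) u v.
Proof.
move=> se emb Yu Yv /rel_divP uv; apply/rel_divP.
have [||c [Cc uc c1]] := stretch_amalgam se emb _ _ uv => //.
  by rewrite over_cat over_inv Yu.
exact: rel_trans uc (proj2 (window_agree se emb Cc) (rel_sym c1)).
Qed.

(** The induction starts from the empty stretch e = s - 1, where the statement is
    vacuous. *)
Lemma windows_embedP s e : s - 1 <= e -> windows_embed s e.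
Proof.
move=> se; rewrite (_ : e = s - 1 + (absz (e - (s - 1))%R)%:Z); last by lia.
elim: (absz _) => [|n IH]; first by move=> k u /andP[? ?]; lia.
have {}se : s - 1 <= s - 1 + n%:Z by lia.
rewrite (_ : s - 1 + n.+1%:Z = (s - 1 + n%:Z) + 1); last by lia.
set d := s - 1 + n%:Z in se IH *.
move=> k u /andP[sk kd] Wu u1; have [E|kne] := eqVneq k (d + 1).
  have [||c [Cc c1 uc]] := stretch_amalgam se IH (u := [::]) _ _ (rel_sym u1) => //.
    apply: sub_over Wu => z /window_above; rewrite !unfold_in /above;
      case: eqP => //= _; lia.
  rewrite E; apply: rel_trans uc (proj1 (window_agree se IH Cc) (rel_sym c1)).
apply: (IH k u _ Wu); first by apply/andP; split => //; lia.
apply: (stretch_below se IH) u1 => //.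
by apply: sub_over Wu => z /window_below; rewrite !unfold_in /below;
  case: eqP => //= _; lia.
Qed.

Definition all_rho : word (X * int)%type -> Prop := fun w => exists j, w = rho j.

(** A derivation uses finitely many relators. *)
Lemma all_rho_stretch u v : rel_eq all_rho u v ->
  exists N : nat, forall n : nat, (N <= n)%N -> rel_eq (stretch (- n%:Z) n%:Z) u v.
Proof.
elim=> {u v} [w|u v _ [n H]|v u w _ [n H] _ [n' H']|u u' v v' _ [n H] _ [n' H']|l|_ [j ->]].
- by exists 0%N => n _; exact: rel_refl.
- by exists n => k nk; exact/rel_sym/H.
- by exists (maxn n n') => k; rewrite geq_max => /andP[/H + /H']; exact: rel_trans.
- by exists (maxn n n') => k; rewrite geq_max => /andP[/H + /H']; exact: rel_cat.
- by exists 0%N => n _; exact: rel_cancel.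
- exists `|j|%N => n jn; apply: rel_rel; exists j => //; apply/andP; split; lia.
Qed.

Theorem window_embed k u : over (window (m + k) (M + k)) u ->
  rel_eq all_rho u [::] -> rel_eq (eq (rho k)) u [::].
Proof.
move=> Wu /all_rho_stretch[N H]; set n := (N + `|k|)%N.
by apply: (windows_embedP _ _ Wu (H n (leq_addr _ _))); [lia | apply/andP; split; lia].
Qed.

(** The relators rho 1, rho 2, ... add generators above M and can be discarded;
    rho 0 is then the last floor of the tower, amalgamated along the window from
    m to M - 1. *)
Theorem lower_meet u v : over (below (M - 1)) u -> over (window m M) v ->
  rel_eq all_rho u v ->
  exists2 c, over (window m (M - 1)) c & rel_eq (eq (rho 0)) v c.
Proof.
move=> Yu Wv /all_rho_stretch[N /(_ N (leqnn N)) uv].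
have {}uv : rel_eq (stretch (- N%:Z) 0) u v.
  elim: {2}N uv => [//|n IH] uv; apply: IH.
  rewrite (_ : n.+1%:Z = n%:Z + 1) in uv; last by lia.
  apply: stretch_below uv; [lia | apply: windows_embedP; lia | |].
    by apply: sub_over Yu => z; rewrite !unfold_in /below; case: eqP => //= _; lia.
  by apply: sub_over Wv => z /window_below; rewrite !unfold_in /below;
    case: eqP => //= _; lia.
have [||||c [Cc _ vc]] := @stretch_amalgam (- N%:Z) (-1) u v _ _ _ _ uv => //; first by lia.
- by apply: windows_embedP; lia.
- by apply: sub_over Wv => z /window_above; rewrite !unfold_in /above;
  case: eqP => //= _; lia.
exists c => //; apply: sub_over Cc => z.
by rewrite !unfold_in /= /below /above; case: eqP => //= _ /andP[? ?]; apply/andP;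
  split; lia.
Qed.

End Tower.

(** * The closed walk of a cyclically reduced word *)

Lemma count_two (T : Type) (x0 : T) (P : pred T) (s : seq T) j k :
  (j < k < size s)%N -> P (nth x0 s j) -> P (nth x0 s k) -> (1 < count P s)%N.
Proof.
move=> /andP[jk ks] Pj Pk; rewrite -(cat_take_drop k s) count_cat.
have sk : size (take k s) = k by rewrite size_take ks.
have h1 : has P (take k s).
  by apply/(has_nthP x0); exists j; rewrite ?sk // nth_take.
have h2 : has P (drop k s).
  by apply/(has_nthP x0); exists 0%N; rewrite ?size_drop ?subn_gt0 // nth_drop addn0.
by rewrite !has_count in h1 h2; rewrite -addn1 leq_add.
Qed.

(** The letters and the levels of the closed walk r are indexed by all natural
    numbers, periodically, which spares the distinction of the base point. *)
Section Cyclic.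
Variables (X : choiceType) (r : word X) (l0 : letter X).
Hypothesis r_nil : r != [::].
Hypothesis r_red : cycred r.
Implicit Types (phi : X -> int) (i : int) (j k : nat).

Definition cletter k := nth l0 r (k %% size r).
Definition lev phi k : int := wt phi (take (k %% size r) r).

Let n_gt0 : (0 < size r)%N. Proof. by case: r r_nil. Qed.
Let modn_lt k : (k %% size r < size r)%N. Proof. by rewrite ltn_mod. Qed.

Lemma lev_succ phi k : wt phi r = 0 -> lev phi k.+1 = lev phi k + lwt phi (cletter k).
Proof.
move=> r0; rewrite /lev /cletter; set j := (k %% size r)%N.
have -> : wt phi (take j r) + lwt phi (nth l0 r j) = wt phi (take j.+1 r).
  by rewrite (take_nth l0) ?modn_lt // -cats1 wt_cat wt_cons wt_nil addr0.
have -> : (k.+1 %% size r = j.+1 %% size r)%N by rewrite -addn1 -modnDml addn1.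
have := modn_lt k; rewrite -/j leq_eqVlt => /predU1P[->|jn].
  by rewrite modnn take0 take_size r0 wt_nil.
by rewrite modn_small.
Qed.

Lemma at_succ k : cletter k.+1 != letter_inv (cletter k).
Proof.
have E j : (j < size r + size r)%N -> nth l0 (r ++ r) j = cletter j.
  move=> j2; rewrite nth_cat /cletter; case: ltnP => jn; first by rewrite modn_small.
  by rewrite -{2}(subnK jn) modnDr modn_small // ltn_subLR.
have -> : cletter k.+1 = cletter (k %% size r).+1.
  by rewrite /cletter -addn1 -modnDml addn1.
have -> : cletter k = cletter (k %% size r) by rewrite /cletter modn_mod.
have kn := modn_lt k; set j := (k %% size r)%N in kn *.
have j2 : (j.+1 < size r + size r)%N by apply: leq_ltn_trans kn _; lia.
rewrite -!E //; last exact: ltnW.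
move: r_red; rewrite /cycred /reduced => /(sortedP l0) H.
by apply: H; rewrite size_cat.
Qed.

Lemma lev_opp phi k : lev (fun z => - phi z) k = - lev phi k.
Proof.
rewrite /lev /wt -sumrN; apply: eq_bigr => l _; by rewrite /lwt; case: l.2.
Qed.

Definition peak phi k := forall j, lev phi j <= lev phi k.

(** Two consecutive letters b do not cancel, so they point the same way and the
    walk is strictly monotonic between them: it has no extremum there. *)
Lemma pass phi b k : wt phi r = 0 -> phi b != 0 -> peak phi k.+1 ->
  (cletter k).1 != b \/ (cletter k.+1).1 != b.
Proof.
move=> r0 b0 top; case: (eqVneq (cletter k).1 b) => [kb|]; last by left.
right; apply/eqP => k1b; have nc := at_succ k.
have E1 := lev_succ k r0; have E2 := lev_succ k.+1 r0.
have sgn : (cletter k.+1).2 = (cletter k).2.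
  apply/eqP; move: nc; apply: contraNT; case: (cletter k) kb => y s /= ->.
  case: (cletter k.+1) k1b => z t /= ->; rewrite /letter_inv /=.
  by case: s t => [] [].
have := top k; have := top k.+2; move: E1 E2.
rewrite /lwt k1b kb sgn; case: (cletter k).2 => /=; lia.
Qed.

Lemma exists_peak phi : exists k, peak phi k.
Proof.
have [|m [M [_ /mapP[k _ EM] H]]] := @seq_min_max _ [seq lev phi k | k <- iota 0 (size r)].
  by rewrite -size_eq0 size_map size_iota -lt0n.
exists k => j; suff /H/andP[_] : lev phi j \in [seq lev phi k | k <- iota 0 (size r)].
  by rewrite EM.
apply/mapP; exists (j %% size r)%N; first by rewrite mem_iota ltn_mod n_gt0.
by rewrite /lev modn_mod.
Qed.

(** The level that names the k-th edge, see [edge]. *)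
Definition elev phi k : int := if (cletter k).2 then lev phi k.+1 else lev phi k.

Lemma size_lift_all phi i u : size (lift_all phi i u) = size u.
Proof. by elim: u i => //= l u IH i; rewrite IH. Qed.

Section Lifted.
Variables (phi : X -> int) (b : X).
Hypothesis r0 : wt phi r = 0.

Lemma nth_lift_all k d : (k < size r)%N ->
  nth d (lift_all phi 0 r) k = (((cletter k).1, elev phi k), (cletter k).2).
Proof.
have H : forall u i k, (k < size u)%N ->
    nth d (lift_all phi i u) k = edge phi (i + wt phi (take k u)) (nth l0 u k).
  elim=> [//|l u IH] i [|j] /= ju; first by rewrite wt_nil addr0.
  by rewrite IH // wt_cons addrA.
move=> kr; rewrite H // /edge add0r /elev lev_succ // /lev /cletter modn_small //.
Qed.

Lemma has_lift_at k : (cletter k).1 != b ->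
  has (fun m => m.1 == ((cletter k).1, elev phi k)) (lift_word phi b 0 r).
Proof.
move=> kb; rewrite /lift_word has_filter -filter_predI -has_filter.
have E j : cletter (j %% size r) = cletter j by rewrite /cletter modn_mod.
have E' j : elev phi (j %% size r) = elev phi j.
  by rewrite /elev E !lev_succ // E /lev modn_mod.
set m := (_, elev phi k).
have kn := modn_lt k.
apply/(has_nthP (m, true)); exists (k %% size r)%N.
  by rewrite size_lift_all.
by rewrite nth_lift_all //= E E' eqxx.
Qed.

Lemma count_lift_at j k a i : (j < k < size r)%N -> a != b ->
  (cletter j).1 = a -> (cletter k).1 = a -> elev phi j = i -> elev phi k = i ->
  (1 < count (fun m => m.1 == (a, i)) (lift_word phi b 0 r))%N.
Proof.
move=> /andP[jk kn] ab ja ka ji ki; rewrite /lift_word count_filter.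
apply: (@count_two _ (a, i, true) _ _ j k).
- by rewrite jk size_lift_all.
- by rewrite nth_lift_all ?(ltn_trans jk) //= ja ji eqxx.
- by rewrite nth_lift_all //= ka ki eqxx.
Qed.

End Lifted.
End Cyclic.

(** * Magnus' induction *)

Section Freiheitssatz.
Variable X : choiceType.
Implicit Types (u v w r : word X) (x b : X) (phi : X -> int).

Definition occurs x w := has (fun l => l.1 == x) w.

(** The exponent sum of x. *)
Definition expo x : word X -> int := wt (fun z => (z == x)%:Z).
Definition pair_weight x (p : int) b (q : int) : X -> int :=
  fun z => if z == x then p else if z == b then q else 0.

Lemma pair_weight_r x p b q : x != b -> pair_weight x p b q b = q.
Proof. by move=> xb; rewrite /pair_weight eq_sym (negbTE xb) eqxx. Qed.

Lemma wt_pair x p b q w : x != b ->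
  wt (pair_weight x p b q) w = p * expo x w + q * expo b w.
Proof.
move=> xb; rewrite /expo; elim: w => [|[z s] w IH]; first by rewrite !wt_nil; lia.
rewrite !wt_cons IH /lwt /pair_weight /=.
case: (eqVneq z x) => [->|_]; first by rewrite (negbTE xb); case: s; lia.
by case: (eqVneq z b) => _; case: s; lia.
Qed.

Lemma expo_over x w : over (predC1 x) w -> expo x w = 0.
Proof.
move=> /allP H; rewrite /expo /wt big_seq big1 // => l /H /=.
by rewrite /lwt => /negbTE ->; rewrite oppr0 if_same.
Qed.

(** The conclusion of the Freiheitssatz: the generators other than x generate a
    free group freely. *)
Definition freiheit r x := forall u, over (predC1 x) u ->
  rel_eq (eq r) u [::] -> pres_eq [::] u [::].

Lemma reduced_power b w : reduced w -> all (fun l => l.1 == b) w ->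
  exists c, w = nseq (size w) (b, c).
Proof.
elim: w => [|[y s] w IH]; first by exists true.
move=> lw /= /andP[/eqP/= yb aw]; rewrite {}yb in lw *; have [c E] :=
  IH (path_sorted lw) aw; exists s; congr (_ :: _).
case: w lw E {IH aw} => //= k w /andP[nc _] [Ek Ew].
suff -> : s = c by rewrite Ek {1}Ew.
by move: nc; rewrite Ek /nocancel /letter_inv; case: c s {Ek Ew} => [] [] //=; rewrite eqxx.
Qed.

Lemma wt_nseq phi n l : wt phi (nseq n l) = n%:Z * lwt phi l.
Proof.
elim: n => [|n IH]; first by rewrite wt_nil mul0r.
by rewrite /= wt_cons IH; lia.
Qed.

(** Lifting is injective on the kernel of phi: a reduced word with trivial lift is
    a power of b, and phi b is not 0. *)
Lemma lift_trivial phi b i w : phi b != 0 -> reduced w -> wt phi w = 0 ->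
  pres_eq [::] (lift_word phi b i w) [::] -> w = [::].
Proof.
move=> b0 rw w0 /(reduced_nontrivial (lift_reduced i b0 rw)) /(congr1 size).
rewrite size_lift /= => /eqP; rewrite -leqn0 leqNgt -has_count -all_predC => aw.
have {aw} : all (fun l => l.1 == b) w by apply: sub_all aw => l /=; rewrite negbK.
move=> /(reduced_power rw)[c E]; move: w0; rewrite E wt_nseq => /eqP.
rewrite mulf_eq0 => /orP[sw|]; first by rewrite (eqP (sw : size w == 0%N)).
by rewrite /lwt /=; case: c {E}; rewrite ?oppr_eq0 (negbTE b0).
Qed.

Lemma free_of_red r u x : over (predC1 x) u -> rel_eq (eq r) u [::] ->
  (forall w, reduced w -> over (predC1 x) w -> rel_eq (eq r) w [::] -> w = [::]) ->
  pres_eq [::] u [::].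
Proof.
move=> xu u1 H; have E := free_red u; suff red1 : red u = [::] by rewrite red1 in E.
apply: H; [exact: red_reduced | exact: over_red |].
exact: rel_trans (rel_sym (free_rel_eq _ E)) u1.
Qed.

End Freiheitssatz.

(** One step of the induction: the group of r is studied through the kernel of phi,
    whose relators are the lifts of r, shorter than r when b occurs in it. *)
Section MagnusStep.
Variables (X : choiceType) (r : word X) (phi : X -> int) (b x : X).
Hypothesis r0 : wt phi r = 0.
Hypothesis b0 : phi b != 0.
Hypothesis xb : x != b.
Hypothesis xr : occurs x r.
Hypothesis IH : forall j z, occurs z (lift_word phi b j r) ->
  freiheit (lift_word phi b j r) z.

Notation rho j := (lift_word phi b j r).

Lemma lift_shift0 j : rho j = map (shift j) (rho 0).
Proof. by rewrite -lift_shift add0r. Qed.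

Lemma occurs_shift z i j : occurs (z, i + j) (rho j) = occurs (z, i) (rho 0).
Proof.
rewrite lift_shift0 /occurs has_map; apply: eq_has => -[[y k] s] /=.
by rewrite !xpair_eqE (inj_eq (addIr j)).
Qed.

Lemma magnus_windows : exists m M,
  [/\ m <= M, occurs (x, m) (rho 0), occurs (x, M) (rho 0),
      forall i, occurs (x, i) (rho 0) -> m <= i <= M &
      forall j, [/\ over (window x (m + j) (M + j)) (rho j),
                    freiheit (rho j) (x, m + j) & freiheit (rho j) (x, M + j)]].
Proof.
have [|m [M [mr Mr H]]] := @seq_min_max _ (levels x (rho 0)).
  have := has_lift phi 0 r xb; rewrite [X in _ = X]xr => /hasP[[[z i] s] + /eqP/= E].
  rewrite E => zr; apply/eqP => E0; suff : i \in levels x (rho 0) by rewrite E0.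
  by rewrite levelsP; apply/hasP; exists (x, i, s).
rewrite !levelsP -!/(occurs _ _) in mr Mr.
exists m, M; split=> //.
- by have /H/andP[] : m \in levels x (rho 0) by rewrite levelsP.
- by move=> i; rewrite /occurs -levelsP => /H.
move=> j; split; last 2 first.
- by apply: IH; rewrite occurs_shift.
- by apply: IH; rewrite occurs_shift.
rewrite /over lift_shift0 all_map; apply/allP => -[[z i] s] zr.
rewrite /window /above /below /=; case: eqP => //= E; rewrite {}E in zr.
have /H/andP[] : i \in levels x (rho 0); last by lia.
by rewrite levelsP; apply/hasP; exists (x, i, s).
Qed.

(** A word without x lifts to a word without any (x, i).  If it is trivial modulo
    all the lifts, the tower makes it trivial modulo a single one, and the
    Freiheitssatz for that lift makes it trivial. *)
Lemma freiheit_lift : freiheit r x.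
Proof.
have [m [M [mM _ _ _ H]]] := magnus_windows.
move=> u xu u1; apply: (free_of_red xu u1) => w rw xw w1.
have [w0 /(_ 0) wl] := lift_rel_eq b r0 w1.
apply: (@lift_trivial _ phi b 0) => //; first by rewrite w0 wt_nil.
have ow := over_lift phi b 0 xw.
have [_ _ top] := H 0; apply: (top (lift_word phi b 0 w)).
  by apply: sub_over ow => -[z i]; rewrite !unfold_in /= xpair_eqE => /negbTE ->.
apply: (@window_embed _ x (fun j => lift_word phi b j r) m M mM _ _ _ 0 _ _ wl).
- by move=> j; have [] := H j.
- by move=> j v; have [_ + _] := H j; apply.
- by move=> j v; have [_ _] := H j; apply.
- by apply: sub_over ow => -[z i]; rewrite !unfold_in /= /above /below /= => ->.
Qed.

End MagnusStep.

Lemma exists_peakS (X : choiceType) (r : word X) (phi : X -> int) :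
  r != [::] -> exists k, peak r phi k.+1.
Proof.
move=> r_nil; have [k pk] := exists_peak r_nil phi.
have n0 : (0 < size r)%N by rewrite lt0n size_eq0.
exists (k + (size r).-1)%N => j; rewrite -addnS prednK //.
by rewrite [X in _ <= X]/lev modnDr; exact: pk.
Qed.

(** The property of one-relator groups on which the theorem rests: it is what an
    ascending decomposition would contradict. *)
Definition not_generated (X : choiceType) (r : word X) x :=
  forall u, over (predC1 x) u -> ~ rel_eq (eq r) [:: (x, false)] u.

Lemma not_occurs_pred (X : choiceType) (Y : pred X) (r : word X) :
  (forall b, occurs b r -> Y b) -> over Y r.
Proof. by move=> H; apply/allP => l lr; apply: H; apply/hasP; exists l. Qed.

(** The case of two letters x and b in which x has exponent sum 0: the letter x
    itself is erased.  Words without x stay at level 0, so the generator to omit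
    is some (b, i) with i different from 0; it exists because the walk turns, by
    [pass], on an edge b both at its highest and at its lowest level, and these
    differ as x occurs. *)
Section TwoLetters.
Variables (X : choiceType) (r : word X) (x b : X).
Hypothesis r_red : cycred r.
Hypothesis xb : x != b.
Hypothesis xr : occurs x r.
Hypothesis br : occurs b r.
Hypothesis two : over (pred2 x b) r.
Hypothesis x0 : expo x r = 0.
Let phi : X -> int := fun z => (z == x)%:Z.
Hypothesis IH : forall j z, occurs z (lift_word phi x j r) ->
  freiheit (lift_word phi x j r) z.

Let r_nil : r != [::]. Proof. by apply: contraL xr => /eqP ->. Qed.
Let l0 : letter X := (x, true).
Let phix : phi x != 0. Proof. by rewrite /phi eqxx. Qed.
Let phib : phi b = 0. Proof. by rewrite /phi eq_sym (negbTE xb). Qed.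

Let at_b k : (cletter r l0 k).1 != x -> (cletter r l0 k).1 = b.
Proof.
have : cletter r l0 k \in r by rewrite mem_nth // ltn_mod lt0n size_eq0.
by move=> /(allP two) /= /orP[/eqP-> |/eqP-> //]; rewrite eqxx.
Qed.

Let extreme (f : X -> int) k : (f = phi \/ f = fun z => - phi z) ->
  peak r f k.+1 -> occurs (b, lev r phi k.+1) (lift_word phi x 0 r).
Proof.
move=> Ef top; have f0 : wt f r = 0.
  case: Ef => ->; first exact: x0.
  by rewrite -[RHS]oppr0 -x0 /expo /wt -sumrN; apply: eq_bigr => l _; rewrite /lwt;
    case: l.2.
have fx : f x != 0 by case: Ef => ->; rewrite ?oppr_eq0.
have [kx|kx] := @pass _ r l0 r_nil r_red f x k f0 fx top.
  have E : elev r l0 phi k = lev r phi k.+1.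
    rewrite /elev; case: ifP => // s; rewrite (lev_succ l0) //.
    by rewrite /lwt s at_b // phib addr0.
  by have := has_lift_at r_nil x0 kx; rewrite -/(occurs _ _) at_b // E.
have E : elev r l0 phi k.+1 = lev r phi k.+1.
  rewrite /elev; case: ifP => // s; rewrite (lev_succ l0) //.
  by rewrite /lwt s at_b // phib oppr0 addr0.
by have := has_lift_at r_nil x0 kx; rewrite -/(occurs _ _) at_b // E.
Qed.

Lemma freiheit_two_letters : freiheit r x.
Proof.
have bx : b != x by rewrite eq_sym.
have [m [M [mM _ _ rng H]]] := magnus_windows x0 phix bx br IH.
have {}mM : m < M.
  rewrite lt_neqAle mM andbT; apply/eqP => EmM.
  have [k1 p1] := exists_peakS phi r_nil.
  have [k2 p2] := exists_peakS (fun z => - phi z) r_nil.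
  have /andP[a1 a2] := rng _ (extreme (or_introl erefl) p1).
  have /andP[c1 c2] := rng _ (extreme (or_intror erefl) p2).
  have const k : lev r phi k = m.
    by have := p1 k; have := p2 k; rewrite !lev_opp; lia.
  have /hasP[l lr /eqP lx] := xr; have := lev_succ l0 r_nil (index l r) x0.
  rewrite !const /cletter modn_small ?index_mem // nth_index // /lwt lx /phi eqxx.
  by case: l.2 => /esym/eqP; rewrite -subr_eq0 addrAC subrr add0r.
move=> u xu u1; apply: (free_of_red xu u1) => w rw xw w1.
have [w0 /(_ 0) wl] := lift_rel_eq x x0 w1.
apply: (@lift_trivial _ phi x 0) => //; first by rewrite w0 wt_nil.
have ow : over (fun z => z.2 == 0) (lift_word phi x 0 w).
  move: xw {rw w1 w0 wl}; elim: w => [//|l w IHw] /= /andP[lx xw].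
  have E : lwt phi l = 0 by move: lx; rewrite /lwt /phi /= => /negbTE ->; case: l.2.
  by rewrite lift_cons over_cat E IHw // lx /over /= E if_same eqxx.
  (* The translate by - m moves the window to the levels from 0 to M - m. *)
have [_ _ top] := H (- m); apply: (top (lift_word phi x 0 w)).
  apply: sub_over ow => -[z i]; rewrite !unfold_in /= xpair_eqE => /eqP ->.
  by rewrite negb_and [0 == _]eq_sym subr_eq0 (gt_eqF mM) orbT.
apply: (@window_embed _ b (fun j => lift_word phi x j r) m M (ltW mM) _ _ _ (- m) _ _ wl).
- by move=> j; have [] := H j.
- by move=> j v; have [_ + _] := H j; apply.
- by move=> j v; have [_ _] := H j; apply.
- apply: sub_over ow => -[z i]; rewrite !unfold_in /= /above /below /= => /eqP ->.
  by rewrite addrN lexx subr_ge0 ltW ?orbT.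
Qed.
End TwoLetters.

(** If r is a power of x, erasing x gives a retraction to the free group. *)
Lemma freiheit_power (X : choiceType) (r : word X) x : over (pred1 x) r -> freiheit r x.
Proof.
move=> xr u xu; suff H v : rel_eq (eq r) u v ->
    pres_eq [::] [seq l <- u | l.1 != x] [seq l <- v | l.1 != x].
  by move/H; rewrite (all_filterP _) //.
elim=> {xu u v} [w|u v _|v u w _ IH1 _|u u' v v' _ IH1 _ IH2|l|w <-].
- exact: pres_refl.
- exact: pres_sym.
- exact: pres_trans.
- by rewrite !filter_cat; exact: pres_cat.
- rewrite /=; case: (l.1 != x); last exact: pres_refl.
  exact: (pres_cancel [::] l).
- rewrite (_ : [seq _ <- r | _] = [::]); first exact: pres_refl.
  apply/eqP; rewrite -size_eq0 size_filter -leqn0 leqNgt -has_count.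
  by apply/hasP => -[l /(allP xr) /= ->].
Qed.

Section NotGenerated.
Variables (X : choiceType) (r : word X) (x : X).
Hypothesis r_red : cycred r.
Hypothesis xr : (1 < count (fun l => l.1 == x) r)%N.
Hypothesis IHf : forall phi b j z, phi b != 0 -> wt phi r = 0 -> occurs b r ->
  occurs z (lift_word phi b j r) -> freiheit (lift_word phi b j r) z.
Hypothesis IHg : forall phi b j z, phi b != 0 -> wt phi r = 0 -> occurs b r ->
  (1 < count (fun m => m.1 == z) (lift_word phi b j r))%N ->
    not_generated (lift_word phi b j r) z.

(** If x = u modulo r with u free of x, counting x shows that its exponent sum in r
    is 1 or -1.  As x occurs twice, another letter b occurs; give x and b weights
    that kill r, and lift the relation to (x, M) = u' with u' a word in the other
    letters.  If the levels of x in the lift of r vary, this contradicts the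
    Freiheitssatz for a lift of r, omitting (x, m).  If they are constant, x
    occurs as often in the shorter lift as in r, and induction applies. *)
Lemma not_generated_lift : not_generated r x.
Proof.
move=> u xu xE; have [k Hk] := wt_rel_eq xE.
have xo : occurs x r by rewrite /occurs has_count; exact: ltnW.
have Ek : k * expo x r = 1.
  have := Hk (fun z => (z == x)%:Z); rewrite -!/(expo _ _) (expo_over xu).
  by rewrite /expo wt_cons wt_nil /lwt /= eqxx; lia.
have [b [bx br]] : exists b, b != x /\ occurs b r.
  apply: contrapT => no.
  have xs : all (fun l => l.1 == x) r.
    apply: (@not_occurs_pred _ (pred1 x)) => b br; apply/negPn/negP => bx.
    by apply: no; exists b.
  have [rr _] := cat_sorted2 r_red.
  have [c E] := reduced_power rr xs.
  move: Ek xr; rewrite all_count in xs; rewrite (eqP xs) => + n1.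
  rewrite E /expo wt_nseq /lwt /= eqxx => Ek.
  have {Ek} : exists k' : int, k' * (size r)%:Z = 1.
    by case: c {E} Ek => Ek; [exists (- k) | exists k]; rewrite -{}Ek; lia.
  case=> k' /(congr1 absz)/eqP; rewrite abszM muln_eq1 => /andP[_ /eqP/= n2].
  by rewrite n2 in n1.
pose phi := pair_weight x (- expo b r) b (expo x r).
have xb : x != b by rewrite eq_sym.
have phib : phi b != 0.
  rewrite /phi /pair_weight (negbTE bx) eqxx; apply/eqP => E.
  by rewrite E mulr0 in Ek.
have r0 : wt phi r = 0 by rewrite wt_pair // mulNr addrC mulrC subrr.
have IH j z : occurs z (lift_word phi b j r) ->
  freiheit (lift_word phi b j r) z by exact: IHf.
have [m [M [mM mr Mr rng H]]] := magnus_windows r0 phib xb xo IH.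
have [_ /(_ M)] := lift_rel_eq b r0 xE.
rewrite lift_cons xb /= /edge /= => /rel_divP; set v := _ ++ _ => vE.
have ou := over_lift phi b M xu.
have Wv : over (window x (m + 0) (M + 0)) v.
  rewrite /v over_cat over_inv; apply/andP; split.
    by rewrite /over /= /window /above /below /= !addr0 eqxx /= mM lexx.
  by apply: sub_over ou => -[z i]; rewrite !unfold_in /= /above /below /= => ->.
have {}vE : rel_eq (eq (lift_word phi b 0 r)) v [::].
  apply: (@window_embed _ x (fun j => lift_word phi b j r) m M mM _ _ _ 0 _ Wv vE).
  - by move=> j; have [] := H j.
  - by move=> j w; have [_ + _] := H j; apply.
  - by move=> j w; have [_ _] := H j; apply.
have [EmM|neq] := eqVneq m M; last first.
  have [_ bot _] := H 0.
  have /bot/(_ vE)/(wt_free (fun z => (z == (x, M))%:Z)) : over (predC1 (x, m + 0)) v.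
    rewrite /v over_cat over_inv; apply/andP; split.
      by rewrite /over /= addr0 xpair_eqE eqxx /= eq_sym neq.
    by apply: sub_over ou => -[z i]; rewrite !unfold_in /= xpair_eqE => /negbTE ->.
  rewrite wt_nil /v wt_cat wt_inv /wt big_seq1 big_seq big1 => [|l /(allP ou)].
    by rewrite /lwt /= eqxx.
  by case: l => [[z i] s] /= zx; rewrite /lwt /= xpair_eqE (negbTE zx) oppr0 if_same.
apply: (IHg (z := (x, M)) phib r0 br _ _ (proj2 (rel_divP _ _ _) vE)).
  rewrite (@eq_in_count _ _ (fun m => (unlift m).1 == x)).
    rewrite -(count_map _ (fun l : letter X => l.1 == x)) lift_fst count_filter.
    apply: leq_trans xr _; apply: sub_count => l /= /eqP ->.
    by rewrite eqxx xb.
  move=> [[z i] s] zr /=; rewrite xpair_eqE; case: eqP => //= E.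
  have := rng i; rewrite EmM => /(_ _)/andP[].
    by apply/hasP; exists (z, i, s) => //=; rewrite E.
  by move=> Mi iM; rewrite eq_le iM.
by apply: sub_over ou => -[z i]; rewrite !unfold_in /= xpair_eqE => /negbTE ->.
Qed.
End NotGenerated.

(** The Freiheitssatz, together with the fact that a generator occurring at least
    twice in the relator is not expressible through the other ones.  The weights
    used for the Freiheitssatz kill r, do not kill some letter other than x, and
    erase that letter: such weights exist unless r has exponent sum 0 in x and
    involves just one more letter, with non-zero exponent sum, or is a power of
    x. *)
Theorem magnus n : forall (X : choiceType) (r : word X) x, (size r <= n)%N ->
  cycred r -> occurs x r ->
  freiheit r x /\
  ((1 < count (fun l => l.1 == x) r)%N -> not_generated r x).
Proof.
elim: n => [|n IH] X r x rn r_red xr; first by case: r rn xr {r_red}.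
have step phi b j z : phi b != 0 -> wt phi r = 0 -> occurs b r ->
    occurs z (lift_word phi b j r) -> freiheit (lift_word phi b j r) z /\
    ((1 < count (fun m => m.1 == z) (lift_word phi b j r))%N ->
      not_generated (lift_word phi b j r) z).
  move=> b0 r0 br; apply: IH; last exact: lift_cycred.
  by rewrite -ltnS; exact: leq_trans (size_lift_lt _ _ br) rn.
have IHf phi b : phi b != 0 -> wt phi r = 0 -> occurs b r -> forall j z,
    occurs z (lift_word phi b j r) -> freiheit (lift_word phi b j r) z.
  by move=> b0 r0 br j z /(step _ _ _ _ b0 r0 br) [].
split; last first.
  move=> xr2; apply: not_generated_lift => // phi b j z b0 r0 br; first exact: IHf.
  move=> zr2; have [|_] := step phi b j z b0 r0 br; last by apply.
  by rewrite /occurs has_count; exact: ltnW.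
have [[b [bx br]]|no] := pselect (exists b, b != x /\ occurs b r); last first.
  apply/freiheit_power/not_occurs_pred => b br.
  by apply/negPn/negP => bx; apply: no; exists b.
have xb : x != b by rewrite eq_sym.
pose phi p q := pair_weight x p b q.
have phib p q : phi p q b = q by rewrite /phi /pair_weight (negbTE bx) eqxx.
have [x0|x0] := eqVneq (expo x r) 0; last first.
  have r0 : wt (phi (- expo b r) (expo x r)) r = 0.
    by rewrite wt_pair // mulNr addrC mulrC subrr.
  by apply: (freiheit_lift r0 _ xb xr); [rewrite phib | apply: IHf; rewrite ?phib].
have [b0|b0] := eqVneq (expo b r) 0.
  have r0 : wt (phi 0 1) r = 0 by rewrite wt_pair // x0 b0.
  by apply: (freiheit_lift r0 _ xb xr); [rewrite phib | apply: IHf; rewrite ?phib].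
have [[c [cx cb cr]]|no] := pselect (exists c, [/\ c != x, c != b & occurs c r]).
  pose psi := pair_weight b (expo c r) c (- expo b r).
  have psic : psi c != 0 by rewrite /psi /pair_weight (negbTE cb) eqxx oppr_eq0.
  have r0 : wt psi r = 0 by rewrite wt_pair 1?eq_sym // mulNr mulrC subrr.
  apply: (freiheit_lift r0 psic _ xr); first by rewrite eq_sym.
  exact: IHf.
apply: (@freiheit_two_letters _ r x b) => //; last by apply: IHf; rewrite ?eqxx.
apply: not_occurs_pred => c cr; rewrite /= ; apply/orP.
have [cx|cx] := eqVneq c x; [by left | right].
by apply/negPn/negP => cb; apply: no; exists c.
Qed.

(** * Heavy tops *)

(** Brown's criterion fails at the top of the walk. *)
Definition heavy_top (X : choiceType) (r : word X) phi (b a : X) :=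
  exists M, (1 < count (fun m => m.1 == (a, M)) (lift_word phi b 0 r))%N /\
            forall i, occurs (a, i) (lift_word phi b 0 r) -> i <= M.

(** The non-ascending half of Brown's criterion: when the top is heavy, the top
    generator is not a product of the lower ones. *)
Theorem top_not_generated (X : choiceType) (r : word X) phi (b x : X) M :
  cycred r -> phi b != 0 -> wt phi r = 0 -> x != b ->
  (1 < count (fun m => m.1 == (x, M)) (lift_word phi b 0 r))%N ->
  (forall i, occurs (x, i) (lift_word phi b 0 r) -> i <= M) ->
  forall u, over (below x (M - 1)) u ->
  ~ rel_eq (lifts phi b r) [:: (x, M, false)] u.
Proof.
move=> r_red b0 r0 xb M2 Mtop.
have Mr : occurs (x, M) (lift_word phi b 0 r) by rewrite /occurs has_count; exact: ltnW.
have xr : occurs x r.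
  rewrite /occurs -(has_lift phi 0 r xb); move: Mr; apply: sub_has => m /eqP E.
  by rewrite E.
have IH j z : occurs z (lift_word phi b j r) -> freiheit (lift_word phi b j r) z.
  by move=> zr; have [] := magnus (leqnn _) (lift_cycred j b0 r0 r_red) zr.
have [m [M' [mM mr M'r rng H]]] := magnus_windows r0 b0 xb xr IH.
have EM : M' = M.
  by apply: le_anti; rewrite (Mtop _ M'r); have /andP[_ ->] := rng _ Mr.
rewrite {}EM in mM M'r rng H => u ou /rel_sym uE.
have [||||c Cc cE] := @lower_meet _ x (fun j => lift_word phi b j r) m M mM _ _ _ u _ ou _ uE.
- by move=> j; have [] := H j.
- by move=> j v; have [_ + _] := H j; apply.
- by move=> j v; have [_ _] := H j; apply.
- by rewrite /over /= /window /above /below /= eqxx mM lexx.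
have [_ /(_ M2)] := magnus (leqnn _) (lift_cycred 0 b0 r0 r_red) Mr.
move/(_ c _ cE); apply; apply: sub_over Cc => -[z i].
rewrite !unfold_in /= /above /below /= xpair_eqE; case: eqP => //= _ /andP[_ iM].
by apply/eqP; lia.
Qed.

(** From here on r is a closed walk in the plane, with steps x and y. *)
Section Peaks.
Variables (X : choiceType) (r : word X) (x y : X).
Hypothesis r_nil : r != [::].
Hypothesis r_red : cycred r.
Hypothesis xy : x != y.
Hypothesis two : over (pred2 x y) r.
Hypothesis x0 : expo x r = 0.
Hypothesis y0 : expo y r = 0.
Implicit Types (j k : nat).

Notation at_ := (cletter r (x, true)).
Notation n := (size r).
Definition coord z k : int := expo z (take (k %% n) r).

Lemma lev_pair p q k : lev r (pair_weight x p y q) k = p * coord x k + q * coord y k.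
Proof. exact: wt_pair. Qed.

Lemma wt_pair0 p q : wt (pair_weight x p y q) r = 0.
Proof. by rewrite wt_pair // x0 y0 !mulr0. Qed.

Lemma at_two k : (at_ k).1 = x \/ (at_ k).1 = y.
Proof.
have : at_ k \in r by rewrite mem_nth // ltn_mod lt0n size_eq0.
by move=> /(allP two) /= /orP[/eqP-> |/eqP->]; [left | right].
Qed.

(** A direction phi = (p, q) whose top is not heavy.  An edge x joins levels that
    differ by p, so its upper end is Num.max p 0 above the level naming it. *)
Section Direction.
Variables (p q : int).
Hypothesis q0 : q != 0.
Hypothesis light : ~ heavy_top r (pair_weight x p y q) y x.
Notation phi := (pair_weight x p y q).
Notation top L := (L - Num.max p 0).

Let phix : phi x = p. Proof. by rewrite /pair_weight eqxx. Qed.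
Let phiy : phi y = q. Proof. by rewrite /pair_weight eq_sym (negbTE xy) eqxx. Qed.
Let r0 := wt_pair0 p q.

Lemma peak_edge k : peak r phi k.+1 -> exists j, [/\ j = k \/ j = k.+1, (at_ j).1 = x &
  elev r (x, true) phi j = top (lev r phi k.+1)].
Proof.
move=> pk; have phiy0 : phi y != 0 by rewrite phiy.
have := pk k; have := pk k.+2.
have := lev_succ (x, true) r_nil k r0; have := lev_succ (x, true) r_nil k.+1 r0.
have xe j : (at_ j).1 != y -> (at_ j).1 = x by case: (at_two j) => ->; rewrite ?eqxx.
case: (pass (x, true) r_nil r_red r0 phiy0 pk) => /xe ex.
  exists k; split=> //; first by left.
  by rewrite /elev; move: (lev_succ (x, true) r_nil k r0) (pk k); rewrite /lwt ex phix;
    case: (at_ k).2; case: (leP p 0); lia.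
exists k.+1; split=> //; first by right.
by rewrite /elev; move: (lev_succ (x, true) r_nil k.+1 r0) (pk k.+2);
  rewrite /lwt ex phix; case: (at_ k.+1).2; case: (leP p 0); lia.
Qed.

Lemma edge_top j k : peak r phi k -> (at_ j).1 = x ->
  elev r (x, true) phi j <= top (lev r phi k).
Proof.
move=> pk ex; have := pk j; have := pk j.+1; rewrite /elev.
by move: (lev_succ (x, true) r_nil j r0); rewrite /lwt ex phix; case: (at_ j).2;
  case: (leP p 0); lia.
Qed.

Lemma occurs_lift i : occurs (x, i) (lift_word phi y 0 r) ->
  exists2 j, (at_ j).1 = x & elev r (x, true) phi j = i.
Proof.
rewrite /occurs /lift_word has_filter -filter_predI -has_filter.
move=> /(has_nthP (x, i, true))[j]; rewrite size_lift_all => jn /=.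
by rewrite (nth_lift_all (x, true)) //= => /andP[/eqP[ex ei] _]; exists j.
Qed.

Lemma top_edge_unique j j' k : peak r phi k -> (at_ j).1 = x -> (at_ j').1 = x ->
  elev r (x, true) phi j = top (lev r phi k) ->
  elev r (x, true) phi j' = top (lev r phi k) -> j = j' %[mod n].
Proof.
move=> pk ej ej' Ej Ej'.
have red_at i : at_ (i %% n) = at_ i by rewrite /cletter modn_mod.
have red_lev i : elev r (x, true) phi (i %% n) = elev r (x, true) phi i.
  by rewrite /elev red_at !(lev_succ (x, true)) // red_at /lev modn_mod.
have H i i' : (i < i' < n)%N -> (at_ i).1 = x -> (at_ i').1 = x ->
    elev r (x, true) phi i = top (lev r phi k) ->
    elev r (x, true) phi i' = top (lev r phi k) -> False.
  move=> ii' ai ai' Ei Ei'; apply: light; exists (top (lev r phi k)); split.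
    exact: (count_lift_at r_nil r0 ii' xy ai ai' Ei Ei').
  by move=> e /occurs_lift[i2 ai2 <-]; exact: edge_top.
have n0 : (0 < n)%N by rewrite lt0n size_eq0.
case: (ltngtP (j %% n)%N (j' %% n)%N) => // lt.
  by case: (H (j %% n)%N (j' %% n)%N); rewrite ?red_at ?red_lev // lt ltn_mod.
by case: (H (j' %% n)%N (j %% n)%N); rewrite ?red_at ?red_lev // lt ltn_mod.
Qed.

(** Each visit of the highest level uses an edge x with an end there, and for non-zero p
    such an edge has only one end on that level: distinct visits use distinct
    edges. *)
Lemma peak_unique k k' : p != 0 -> peak r phi k.+1 -> peak r phi k'.+1 ->
  k = k' %[mod n].
Proof.
move=> p0 pk pk'.
have [j [jk ej Ej]] := peak_edge pk; have [j' [jk' ej' Ej']] := peak_edge pk'.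
have EL : lev r phi k'.+1 = lev r phi k.+1.
  by apply: le_anti; rewrite pk pk'.
have E := top_edge_unique pk ej ej' Ej (etrans Ej' (congr1 (fun L => top L) EL)).
have levE i i' : i = i' %[mod n] -> lev r phi i = lev r phi i'.
  by move=> e; rewrite /lev e.
have ne i : (at_ i).1 = x -> lev r phi i.+1 != lev r phi i.
  move=> ei; rewrite (lev_succ (x, true)) // /lwt ei phix -subr_eq0 addrAC subrr add0r.
  by case: (at_ i).2; rewrite ?oppr_eq0.
have SE i i' : i.+1 = i'.+1 %[mod n] -> i = i' %[mod n].
  by move=> /eqP; rewrite -(addn1 i) -(addn1 i') eqn_modDr => /eqP.
have ES i i' : i = i' %[mod n] -> i.+1 = i'.+1 %[mod n].
  by move=> e; apply/eqP; rewrite -(addn1 i) -(addn1 i') eqn_modDr; apply/eqP.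
case: jk jk' => -> [] -> in E ej ej' {Ej Ej'} * => //.
- by move: (ne _ ej); rewrite -EL (levE _ _ (esym E)) eqxx.
- by move: (ne _ ej'); rewrite EL (levE _ _ E) eqxx.
- exact: SE.
Qed.

End Direction.
End Peaks.

(** * Walks without heavy tops *)

Lemma small_commutator (X : choiceType) (r : word X) (x y : X) :
  x != y -> r != [::] -> cycred r -> over (pred2 x y) r ->
  expo x r = 0 -> expo y r = 0 -> (size r <= 4)%N ->
  exists l m, [/\ l.1 != m.1 & r = [:: l; m; letter_inv l; letter_inv m]].
Proof.
move=> xy r_nil r_red two; have /negbTE yx : y != x by rewrite eq_sym.
move: (xy) => /negbTE xyF; rewrite /expo.
case: r r_nil r_red two => [//|[z1 s1] [|[z2 s2] [|[z3 s3] [|[z4 s4] [|//]]]]] _;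
  rewrite /cycred /reduced /nocancel /letter_inv /over /= ?andbT => nc two e1 e2 _.
- exfalso; case/orP: two nc e1 e2 => /eqP->;
  rewrite !wt_cons !wt_nil /lwt /= !eqxx ?xyF ?yx; by case: s1.
- exfalso; case/andP: two nc e1 e2 => /orP[]/eqP-> /orP[]/eqP->;
  rewrite !wt_cons !wt_nil /lwt /= !xpair_eqE !eqxx ?xyF ?yx; by case: s1; case: s2.
- exfalso; case/and3P: two nc e1 e2 => /orP[]/eqP-> /orP[]/eqP-> /orP[]/eqP->;
  rewrite !wt_cons !wt_nil /lwt /= !xpair_eqE !eqxx ?xyF ?yx;
  by case: s1; case: s2; case: s3.
- exists (z1, s1), (z2, s2);
  case/and4P: two nc e1 e2 => /orP[]/eqP-> /orP[]/eqP-> /orP[]/eqP-> /orP[]/eqP->;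
  rewrite !wt_cons !wt_nil /lwt /= !xpair_eqE !eqxx ?xyF ?yx;
  by case: s1; case: s2; case: s3; case: s4 => //= _ _ _; rewrite ?yx ?xyF.
Qed.

Section Square.
Variables (X : choiceType) (r : word X) (x y : X).
Hypothesis r_nil : r != [::].
Hypothesis r_red : cycred r.
Hypothesis xy : x != y.
Hypothesis two : over (pred2 x y) r.
Hypothesis x0 : expo x r = 0.
Hypothesis y0 : expo y r = 0.
Hypothesis light : forall p q, q != 0 -> ~ heavy_top r (pair_weight x p y q) y x.
Implicit Types (s t : int) (j k : nat).

Notation n := (size r).
Notation cx := (coord r x).
Notation cy := (coord r y).

Let n_gt0 : (0 < n)%N. Proof. by rewrite lt0n size_eq0. Qed.

Let before k := (k + n.-1)%N.
Let beforeS k : (before k).+1 = k %[mod n].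
Proof. by rewrite /before -addnS prednK // modnDr. Qed.

Let coordE z k : coord r z (before k).+1 = coord r z k.
Proof. by rewrite /coord beforeS. Qed.

(** A corner of the bounding box, selected by the signs of s and t. *)
Definition corner s t k := forall j, s * cx j <= s * cx k /\ t * cy j <= t * cy k.

(** Let k be, among the points with largest t y, the one with largest s x.  If it is
    not the corner, some points lie further in the direction of s x; the line
    through k and the one among them of least slope supports the walk in two
    points, so its normal direction has two peaks. *)
Lemma exists_corner s t : s != 0 -> t != 0 -> exists k, corner s t k.
Proof.
move=> s0 t0.
have [|_m [Y [_ /mapP[k0 _ Yk0] HY]]] := @seq_min_max _ [seq t * cy k | k <- iota 0 n].
  by rewrite -size_eq0 size_map size_iota -lt0n.
have lty j : t * cy j <= Y.
  have /HY/andP[_] : t * cy (j %% n)%N \in [seq t * cy k | k <- iota 0 n].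
    by apply: map_f; rewrite mem_iota ltn_mod n_gt0.
  by rewrite /coord modn_mod.
pose tops := [seq k <- iota 0 n | t * cy k == Y].
have topsP j : t * cy j = Y -> (j %% n)%N \in tops.
  move=> jY; rewrite mem_filter mem_iota ltn_mod n_gt0 /=.
  by rewrite /coord modn_mod -/(coord r y j) jY eqxx.
have [|_m1 [W [_ /mapP[k kt Wk] HW]]] := @seq_min_max _ [seq s * cx k | k <- tops].
  rewrite -size_eq0 size_map size_eq0; apply/eqP => E.
  by have := topsP k0 (esym Yk0); rewrite E.
have kY : t * cy k = Y by move: kt; rewrite mem_filter => /andP[/eqP].
have ltx j : t * cy j = Y -> s * cx j <= s * cx k.
  move=> /topsP jt; have /HW/andP[_] := map_f (fun k => s * cx k) jt.
  by rewrite Wk /coord modn_mod.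
exists k => j; split; last by rewrite kY.
rewrite leNgt; apply/negP => jk.
pose slope i : rat := (Y - t * cy i)%:~R / (s * cx i - s * cx k)%:~R.
pose rights := [seq i <- iota 0 n | s * cx k < s * cx i].
have rightsP i : s * cx k < s * cx i -> (i %% n)%N \in rights.
  by move=> ik; rewrite mem_filter mem_iota ltn_mod n_gt0 /= /coord modn_mod -/(coord r x i) ik.
have [|V [_M [/mapP[i ir Vi] _ HV]]] := @seq_min_max _ [seq slope i | i <- rights].
  rewrite -size_eq0 size_map size_eq0; apply/eqP => E.
  by have := rightsP j jk; rewrite E.
have {ir} ki : s * cx k < s * cx i by move: ir; rewrite mem_filter => /andP[].
pose q := s * cx i - s * cx k; pose p := Y - t * cy i.
have q_gt0 : 0 < q by rewrite subr_gt0.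
have p_gt0 : 0 < p.
  rewrite subr_gt0 lt_neqAle lty andbT; apply/eqP => /ltx.
  by rewrite leNgt ki.
have below_line l : p * (s * cx l) + q * (t * cy l) <= p * (s * cx k) + q * Y.
  have [lk|lk] := lerP (s * cx l) (s * cx k).
    by apply: lerD; rewrite ler_pM2l.
  have /HV/andP[+ _] : slope (l %% n)%N \in [seq slope i | i <- rights].
    by apply/map_f/rightsP.
  rewrite Vi /slope /coord modn_mod -/(coord r x l) -/(coord r y l) -/(coord r x i) -/(coord r y i).
  rewrite ler_pdivrMr ?ltr0z // mulrAC ler_pdivlMr ?ltr0z ?subr_gt0 //.
  rewrite -!intrM ler_int -/p -/q => H.
  rewrite -lerBrDl -mulrBr in H *.
  rewrite -subr_ge0; move: H; rewrite -subr_ge0; congr (0 <= _).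
  by rewrite !mulrBr !mulrBl; lia.
have ph : s * p != 0 by rewrite mulf_neq0 // gt_eqF.
have qh : t * q != 0 by rewrite mulf_neq0 // gt_eqF.
have levE l : lev r (pair_weight x (s * p) y (t * q)) l = p * (s * cx l) + q * (t * cy l).
  by rewrite lev_pair //; congr (_ + _); rewrite mulrA; congr (_ * _); exact: mulrC.
have pk : peak r (pair_weight x (s * p) y (t * q)) (before k).+1.
  by move=> l; rewrite !levE !coordE kY.
have pi : peak r (pair_weight x (s * p) y (t * q)) (before i).+1.
  move=> l; rewrite !levE !coordE; apply: le_trans (below_line l) _.
  by rewrite /p /q !mulrBl; lia.
have /eqP := peak_unique r_nil r_red xy two x0 y0 qh (light qh) ph pk pi.
rewrite eqn_modDr => /eqP E.
by move: ki; rewrite /coord E ltxx.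
Qed.

(** All points on the top side are ends of the only edge x on that side. *)
Lemma top_width t k k' : t != 0 -> (forall j, t * cy j <= t * cy k) ->
  (forall j, t * cy j <= t * cy k') -> `|cx k - cx k'| <= 1.
Proof.
move=> t0 top top'; pose phi := pair_weight x 0 y t.
have levE j : lev r phi j = t * cy j by rewrite lev_pair // mul0r add0r.
have pk : peak r phi (before k).+1 by move=> j; rewrite !levE coordE.
have pk' : peak r phi (before k').+1 by move=> j; rewrite !levE coordE.
have [j [jk ej Ej]] := peak_edge r_nil r_red xy two x0 y0 t0 pk.
have [j' [jk' ej' Ej']] := peak_edge r_nil r_red xy two x0 y0 t0 pk'.
have EL : lev r phi (before k').+1 = lev r phi (before k).+1.
  by apply: le_anti; rewrite pk pk'.
rewrite EL in Ej'.
have E := top_edge_unique r_nil r_red xy two x0 y0 t0 (light t0) pk ej ej' Ej Ej'.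
have step i : (cletter r (x, true) i).1 = x -> `|cx i.+1 - cx i| = 1.
  move=> ei; have -> : cx i.+1 = cx i + lwt (fun z => (z == x)%:Z) (cletter r (x, true) i).
    exact: (lev_succ (x, true) r_nil i x0).
  by rewrite addrAC subrr add0r /lwt ei eqxx; case: ifP.
have same z i i' : i = i' %[mod n] -> coord r z i = coord r z i'.
  by rewrite /coord => ->.
have sameS z i i' : i = i' %[mod n] -> coord r z i.+1 = coord r z i'.+1.
  by move=> e; apply: same; rewrite -(addn1 i) -(addn1 i') -modnDml e modnDml.
rewrite -(coordE x k) -(coordE x k').
case: jk jk' => Ejk [] Ejk'; rewrite {}Ejk {}Ejk' in E ej ej' Ej Ej'.
- by rewrite (sameS x _ _ E) subrr.
- by rewrite -(same x _ _ E) step.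
- by rewrite (same x _ _ E) distrC step.
- by rewrite (same x _ _ E) subrr.
Qed.

(** The bounding box has height at most 1, so that each edge x lies on the top or on
    the bottom side, and each side contains at most one of them. *)
Lemma few_letters : (forall s t, s != 0 -> t != 0 -> exists k, corner s t k) ->
  (forall k k', (forall j, cx j <= cx k) -> (forall j, cx j <= cx k') ->
    `|cy k - cy k'| <= 1) ->
  (count (fun l => l.1 == x) r <= 2)%N.
Proof.
move=> corners side.
have [k1 c1] := corners 1 1 isT isT; have [k2 c2] := corners 1 (-1) isT isT.
have top1 j : 1 * cy j <= 1 * cy k1 by have [] := c1 j.
have top2 j : -1 * cy j <= -1 * cy k2 by have [] := c2 j.
have narrow : `|cy k1 - cy k2| <= 1.
  apply: side => j; first by have [+ _] := c1 j; rewrite !mul1r.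
  by have [+ _] := c2 j; rewrite !mul1r.
pose js := [seq j <- iota 0 n | (cletter r (x, true) j).1 == x].
have E : count (fun l => l.1 == x) r = size js.
  rewrite size_filter -[in LHS](mkseq_nth (x, true) r) /mkseq count_map.
  apply: eq_in_count => j; rewrite mem_iota /= => jn.
  by rewrite /cletter modn_small.
have flat i : (cletter r (x, true) i).1 = x -> cy i.+1 = cy i.
  move=> ei; rewrite (_ : cy i.+1 = cy i + lwt (fun z => (z == y)%:Z) (cletter r (x, true) i)).
    by rewrite /lwt ei (negbTE xy) oppr0 if_same addr0.
  exact: (lev_succ (x, true) r_nil i y0).
have elevE t j : (cletter r (x, true) j).1 = x ->
    elev r (x, true) (pair_weight x 0 y t) j = t * cy j.
  by move=> ej; rewrite /elev !lev_pair // !mul0r !add0r flat // if_same.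
have uniq_top t k j j' : t != 0 -> (forall i, t * cy i <= t * cy k) ->
    j \in js -> j' \in js -> cy j = cy k -> cy j' = cy k -> j = j'.
  move=> t0 top; rewrite !mem_filter !mem_iota /= => /andP[/eqP ej jn] /andP[/eqP ej' jn'] Ej Ej'.
  have pk : peak r (pair_weight x 0 y t) k.
    by move=> i; rewrite !lev_pair // !mul0r !add0r.
  have := top_edge_unique r_nil r_red xy two x0 y0 t0 (light t0) pk ej ej'.
  rewrite !elevE // lev_pair // mul0r add0r Ej Ej' subr0 => /(_ erefl erefl).
  by rewrite !modn_small.
rewrite E -(size_map (fun j => cy j == cy k1)).
apply: (@uniq_leq_size _ _ [:: true; false]); last by case=> _; rewrite !inE.
rewrite map_inj_in_uniq ?filter_uniq ?iota_uniq // => j j' jj jj'.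
have [e|ne] := eqVneq (cy j) (cy k1) => /esym; first by move/eqP=> e';
  exact: (uniq_top 1 k1).
move=> /negbT ne'; apply: (uniq_top (-1) k2) => //.
  by have := top1 j; have := top2 j; move/eqP: ne; lia.
by have := top1 j'; have := top2 j'; move/eqP: ne'; lia.
Qed.

End Square.

(** Without heavy tops the walk goes around a unit square. *)
Theorem light_commutator (X : choiceType) (r : word X) (x y : X) :
  r != [::] -> cycred r -> x != y -> over (pred2 x y) r ->
  expo x r = 0 -> expo y r = 0 ->
  (forall p q, q != 0 -> ~ heavy_top r (pair_weight x p y q) y x) ->
  (forall p q, q != 0 -> ~ heavy_top r (pair_weight y p x q) x y) ->
  exists l m, [/\ l.1 != m.1 & r = [:: l; m; letter_inv l; letter_inv m]].
Proof.
move=> r_nil r_red xy two x0 y0 lx ly; apply: (small_commutator xy) => //.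
have yx : y != x by rewrite eq_sym.
have two' : over (pred2 y x) r by apply: sub_over two => z; rewrite !unfold_in /= orbC.
have cx : (count (fun l => l.1 == x) r <= 2)%N.
  apply: (@few_letters X r x y) => //; first exact: exists_corner.
  by move=> k k' h h'; apply: (@top_width X r y x _ _ _ _ _ _ _ 1) => // j; rewrite !mul1r.
have cy : (count (fun l => l.1 == y) r <= 2)%N.
  apply: (@few_letters X r y x) => //; first exact: exists_corner.
  by move=> k k' h h'; apply: (@top_width X r x y _ _ _ _ _ _ _ 1) => // j; rewrite !mul1r.
rewrite -(count_predC (fun l => l.1 == x)) (@leq_add _ _ 2 2) //.
apply: leq_trans cy; rewrite leq_eqVlt; apply/orP; left; apply/eqP.
apply: eq_in_count => l /(allP two) /= /orP[]/eqP->; first by rewrite eqxx (negbTE xy).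
by rewrite eqxx yx.
Qed.


(** * The group of the presentation *)

Section PresGroup.
Variables (X : choiceType) (r : word X).
Implicit Types (u v w : word X) (l : letter X).

Definition cls u : pres_group r := (\pi_(pres_group r) u)%qT.

Lemma cls_surj (a : pres_group r) : exists u, a = cls u.
Proof. exact: pres_surj. Qed.

Lemma cls_eq u v : cls u = cls v <-> pres_eq r u v.
Proof. exact: pres_piP. Qed.

Lemma cls_cat u v : cls (u ++ v) = (cls u * cls v)%g.
Proof. exact/esym/pres_mul_pi. Qed.

Lemma cls_inv u : cls (word_inv u) = (cls u)^-1%g.
Proof. exact/esym/pres_inv_pi. Qed.

Lemma cls_nil : cls [::] = 1%g.
Proof. by []. Qed.

Lemma wt_cls f u v : wt f r = 0 -> cls u = cls v -> wt f u = wt f v.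
Proof.
by move=> r0 /cls_eq /pres_rel_eq /wt_rel_eq [k ->]; rewrite r0 mulr0 addr0.
Qed.

(** A letter l with exponent sum 0 is followed by its inverse somewhere, and
    l a l^-1 b is the product of the commutator of l^-1 and a^-1 with a b. *)
Lemma cls_expo0 (H : {pred pres_group r}) : group_closed H ->
  (forall a b : pres_group r, [~ a, b]%g \in H) ->
  forall u, (forall z, expo z u = 0) -> cls u \in H.
Proof.
move=> gH comH u; elim: (size u) {-2}u (leqnn (size u)) => {u} [|n IH] u.
  by case: u => // _ _; case: gH.
case: u => [|l u] un u0; first by case: gH.
have lu : letter_inv l \in u.
  apply/negPn/negP => nl.
  have pos : forall w, letter_inv l \notin w ->
      0 <= lwt (fun z => (z == l.1)%:Z) l * expo l.1 w.
    elim=> [|m w IHw]; first by rewrite /expo wt_nil mulr0.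
    rewrite inE negb_or => /andP[ml /IHw]; rewrite /expo wt_cons mulrDr => IHw'.
    apply: addr_ge0 => //; move: ml; rewrite /lwt /letter_inv eqxx.
    case: l m {un u0 nl IHw IHw'} => z s [z' s'] /=; rewrite xpair_eqE.
    by case: (eqVneq z' z) => _ /=; case: s s' => [] [].
  have := pos _ nl; have := u0 l.1; rewrite /expo wt_cons => /eqP.
  rewrite addrC addr_eq0 => /eqP ->; rewrite /lwt eqxx.
  by case: l.2.
case: (splitPr lu) un u0 => a b un u0.
have -> : cls (l :: a ++ letter_inv l :: b) =
    ([~ (cls [:: l])^-1, (cls a)^-1] * cls (a ++ b))%g.
  rewrite -cat1s -[letter_inv l :: b]cat1s !cls_cat (_ : [:: letter_inv l] = word_inv [:: l]) //.
  by rewrite cls_inv /commg /conjg !invgK !mulgA mulgVK.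
apply: (group_closedM gH); first exact: comH.
apply: IH => [|z]; first by move: un; rewrite /= !size_cat /= addnS ltnS; exact: ltnW.
rewrite -(u0 z) /expo wt_cons !wt_cat wt_cons lwt_inv.
lia.
Qed.

Definition wpow u (k : int) : word X :=
  match k with
  | Posz n => flatten (nseq n u)
  | Negz n => flatten (nseq n.+1 (word_inv u))
  end.

Lemma wt_wpow f u k : wt f (wpow u k) = k * wt f u.
Proof.
have H n w : wt f (flatten (nseq n w)) = n%:Z * wt f w.
  elim: n => [|n IH]; first by rewrite wt_nil mul0r.
  by rewrite /= wt_cat IH intS mulrDl mul1r.
by case: k => n; rewrite /wpow H // wt_inv NegzE mulrN mulNr.
Qed.

Lemma cls_wpow u k : cls (wpow u k) = expgz (cls u) k.
Proof.
have H n w : cls (flatten (nseq n w)) = (cls w ^+ n)%g.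
  by elim: n => [|n IH] //=; rewrite cls_cat IH expgS.
by case: k => n; rewrite /wpow /expgz H // cls_inv expVgn.
Qed.

End PresGroup.

Section TwoGenerators.
Variable r : word 'I_2.
Notation x := (ord0 : 'I_2).
Notation y := (ord_max : 'I_2).

Lemma ord2 (z : 'I_2) : z = x \/ z = y.
Proof. by case: z => -[|[|//]] i; [left | right]; apply: val_inj. Qed.

(** If the exponent vector of r is not 0, the classes of any two elements become
    linearly dependent modulo it: Cramer's rule gives the coefficients,
    and if these vanish both vectors are parallel to that of r, hence dependent. *)
Lemma betti2_expo0 : first_betti (pres_group r) 2 -> expo x r = 0 /\ expo y r = 0.
Proof.
move=> [[t indep] _].
have [u0 E0] := cls_surj (t ord0); have [u1 E1] := cls_surj (t ord_max).
set al := expo x r; set be := expo y r.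
pose v0 z := expo z u0; pose v1 z := expo z u1.
have dep k0 k1 c : (forall z, k0 * v0 z + k1 * v1 z = c * expo z r) ->
    k0 = 0 /\ k1 = 0.
  move=> E; pose k (i : 'I_2) := if i == ord0 then k0 else k1.
  suff /indep kz : in_derived (\prod_(i < 2) expgz (t i) (k i))%g.
    by split; [exact: (kz ord0) | exact: (kz ord_max)].
  rewrite big_ord_recl big_ord_recl big_ord0 mulg1 (_ : lift _ _ = ord_max);
    last exact: val_inj.
  rewrite E0 E1 /k /= -!cls_wpow -cls_cat => H gH comH.
  have -> : cls r (wpow u0 k0 ++ wpow u1 k1) =
            cls r ((wpow u0 k0 ++ wpow u1 k1) ++ wpow r (- c)).
    rewrite [RHS]cls_cat cls_wpow (_ : cls r r = 1%g) ?mulg1; last first.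
      by apply/cls_eq; exact: pres_rel.
    by rewrite (_ : expgz _ _ = 1%g) ?mulg1 //; case: (- c) => n;
      rewrite /expgz expg1n ?invg1.
  apply: cls_expo0 => // [a b|z]; first by apply: comH; exists a, b.
  by rewrite /expo !wt_cat !wt_wpow -/(expo _ _) -/(expo _ _) -/(expo _ _) E mulNr subrr.
pose D := v0 x * v1 y - v1 x * v0 y.
have ord2E (P : 'I_2 -> Prop) : P x -> P y -> forall z, P z.
  by move=> Px Py z; case: (ord2 z) => ->.
have [k0 k1] : al * v1 y - be * v1 x = 0 /\ be * v0 x - al * v0 y = 0.
  by apply: (dep _ _ D); apply: ord2E; rewrite /D -/al -/be; lia.
have [[alz bez]|ne] := pselect (al = 0 /\ be = 0); first by [].
have D0 : D = 0.
  have aD : al * D = 0.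
    have -> : al * D = v0 x * (al * v1 y - be * v1 x) + v1 x * (be * v0 x - al * v0 y).
      by rewrite /D; lia.
    by rewrite k0 k1 !mulr0.
  have bD : be * D = 0.
    have -> : be * D = v1 y * (be * v0 x - al * v0 y) + v0 y * (al * v1 y - be * v1 x).
      by rewrite /D; lia.
    by rewrite k0 k1 !mulr0.
  apply/eqP; apply: contra_notT ne => Dn; move/eqP: aD; move/eqP: bD.
  by rewrite !mulf_eq0 (negbTE Dn) !orbF => /eqP -> /eqP ->.
have [a1 a2] : v1 y = 0 /\ - v0 y = 0.
  by apply: (dep _ _ 0); apply: ord2E; rewrite mul0r; move: D0; rewrite /D; lia.
have [a3 a4] : v1 x = 0 /\ - v0 x = 0.
  by apply: (dep _ _ 0); apply: ord2E; rewrite mul0r; move: D0; rewrite /D; lia.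
have [] : (1 : int) = 0 /\ (0 : int) = 0; last by [].
by apply: (dep _ _ 0); apply: ord2E; lia.
Qed.

Lemma same_generator (X : choiceType) (k l : letter X) :
  k.1 = l.1 -> k = l \/ k = letter_inv l.
Proof.
by case: k l => z s [z' s'] /= ->; rewrite /letter_inv /=; case: s s' => [] []; auto.
Qed.

Lemma commutator_Z2 (l m : letter 'I_2) : l.1 != m.1 ->
  r = [:: l; m; letter_inv l; letter_inv m] -> iso_Z2 (pres_group r).
Proof.
move=> lm rE; pose cl := cls r.
have clI k : cl [:: letter_inv k] = (cl [:: k])^-1%g.
  by rewrite /cl (_ : [:: letter_inv k] = word_inv [:: k]) // cls_inv.
have comlm : commute (cl [:: l]) (cl [:: m]).
  have : cl ([:: l] ++ [:: m] ++ [:: letter_inv l] ++ [:: letter_inv m]) = 1%g.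
    by rewrite /= -rE; apply/cls_eq; exact: pres_rel.
  rewrite /cl !cls_cat -!/(cl _) !clI.
  rewrite !mulgA => /(canRL (mulgK _)) /(canRL (mulgK _)); rewrite mul1g !invgK.
  by rewrite /commute.
have letters k : [\/ cl [:: k] = cl [:: l], cl [:: k] = (cl [:: l])^-1%g,
    cl [:: k] = cl [:: m] | cl [:: k] = (cl [:: m])^-1%g].
  rewrite -!clI; have [E|E] : k.1 = l.1 \/ k.1 = m.1.
  - by case: (ord2 k.1) (ord2 l.1) (ord2 m.1) lm => -> [] -> [] ->; rewrite ?eqxx //; auto.
  - by case: (same_generator E) => ->; [exact: Or41 | exact: Or42].
  - by case: (same_generator E) => ->; [exact: Or43 | exact: Or44].
have commV (a b : pres_group r) : commute a b -> commute a^-1%g b.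
  by move=> ab; exact/commute_sym/commuteV/commute_sym.
have com_gen k : commute (cl [:: k]) (cl [:: l]) /\ commute (cl [:: k]) (cl [:: m]).
  have comml := commute_sym comlm.
  by case: (letters k) => ->; split=> //; apply: commV.
have com_letter (a : pres_group r) k : commute a (cl [:: k]).
  have [u ->] := cls_surj a; apply: commute_sym; elim: u => [|k' u IH].
    exact: commute1.
  rewrite -[k' :: u]cat1s cls_cat; apply: commuteM => //.
  have [kl km] := com_gen k.
  by rewrite -/(cl [:: k']); case: (letters k') => -> //; exact: commuteV.
have comm (a b : pres_group r) : commute a b.
  have [v ->] := cls_surj b; elim: v => [|k v IH]; first exact: commute1.
  by rewrite -[k :: v]cat1s cls_cat; apply: commuteM.
have r0 z : expo z r = 0 by rewrite rE /expo !wt_cons wt_nil !lwt_inv; lia.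
pose f (a : pres_group r) : int * int := (expo x (repr a), expo y (repr a)).
pose g (ij : int * int) : pres_group r :=
  cl (wpow [:: (x, false)] ij.1 ++ wpow [:: (y, false)] ij.2).
have fE u : f (cl u) = (expo x u, expo y u).
  by congr (_, _); apply: (@wt_cls _ r);
    [exact: r0 | exact: reprK | exact: r0 | exact: reprK].
exists f; split; last first.
  move=> a b; have [[u ->] [v ->]] := (cls_surj a, cls_surj b).
  by rewrite -cls_cat !fE /expo !wt_cat.
exists g => [a|[i j]].
  have [u ->] := cls_surj a; rewrite fE /g.
  set w := _ ++ _; apply/eqP;
    rewrite -(inj_eq (mulIg (cl u)^-1)%g) mulgV /cl -cls_inv -cls_cat.
  have : cls r (w ++ word_inv u) \in pred1 (1%g : pres_group r); last by [].
  apply: cls_expo0 => [|b c|z].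
  - split; first by rewrite !inE.
    by move=> b c; rewrite !inE => /eqP-> /eqP->; rewrite mulgV.
  - by rewrite inE /commg /conjg (comm b c) mulKg mulVg.
  - rewrite /expo wt_cat wt_inv wt_cat !wt_wpow /= !wt_cons !wt_nil /lwt /=.
    by case: (ord2 z) => -> /=; rewrite !addr0 mulr1 mulr0 ?addr0 ?add0r; exact: subrr.
by rewrite fE; congr (_, _); rewrite /expo wt_cat !wt_wpow !wt_cons !wt_nil /lwt /=; lia.
Qed.

End TwoGenerators.

(** * The half-space of a heavy direction *)

(** The walk of v from level i does not exceed level 0 after its first step, as in
    a path of the half-space of the Cayley graph. *)
Fixpoint stays (X : choiceType) (f : X -> int) (i : int) (v : word X) : bool :=
  if v is l :: v' then (i + lwt f l <= 0) && stays f (i + lwt f l) v' else true.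

Lemma stays_lift (X : choiceType) (x y : X) p q M i v : x != y -> i <= 0 ->
  stays (pair_weight x p y q) i v ->
  over (below x (M - Num.max p 0)) (lift_word (pair_weight x p y q) y (M + i) v).
Proof.
move=> xy; elim: v i => [//|l v IH] i i0 /= /andP[il sv].
rewrite lift_cons over_cat -addrA IH // andbT; case: eqP => //= ly.
rewrite /over /= andbT /below /=; case: eqP => //= lx.
move: il; rewrite /lwt /pair_weight lx eqxx; case: l.2; case: (leP p 0); lia.
Qed.

(** The word T is the commutator of y, oriented upwards, with x.  Started just low
    enough, it goes around (x, M) and returns along the translate of that edge by
    phi y; a word staying in the half-space lifts to lower generators only, so
    it cannot represent the same element by [top_not_generated]. *)
Theorem heavy_halfspace (X : choiceType) (r : word X) (x y : X) p q :
  cycred r -> x != y -> q != 0 -> wt (pair_weight x p y q) r = 0 ->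
  heavy_top r (pair_weight x p y q) y x ->
  exists T, wt (pair_weight x p y q) T = 0 /\
    forall v, stays (pair_weight x p y q) 0 v -> ~ rel_eq (eq r) T v.
Proof.
move=> r_red xy q0 r0 [M [M2 Mtop]]; set phi := pair_weight x p y q in r0 M2 Mtop *.
have phix : phi x = p by rewrite /phi /pair_weight eqxx.
have phiy : phi y = q by rewrite /phi /pair_weight eq_sym (negbTE xy) eqxx.
have phiy0 : phi y != 0 by rewrite phiy.
have key := top_not_generated r_red phiy0 r0 xy M2 Mtop.
pose up : letter X := (y, q < 0).
have wup : lwt phi up = `|q| by rewrite /lwt /= phiy; case: ltP; lia.
have q1 : 1 <= `|q| by lia.
have oM : over (below x (M - 1)) [:: ((x, M - `|q|), false)].
  by rewrite /over /= /below /= eqxx /=; lia.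
have low v : stays phi 0 v ->
  over (below x (M - 1)) (lift_word phi y (M - `|q| + Num.max p 0) v).
  move=> sv; have := stays_lift (M - `|q| + Num.max p 0) xy (lexx 0) sv.
  rewrite addr0 addrK; apply: sub_over => -[z i]; rewrite !unfold_in /below /=.
  by case: eqP => //= _; lia.
have [p0|p0] := leP 0 p.
  exists [:: (x, true); up; (x, false); letter_inv up]; split.
    by rewrite !wt_cons wt_nil lwt_inv /lwt /= phix; lia.
  move=> v sv Tv; have [_ /(_ (M - `|q| + Num.max p 0))] := lift_rel_eq y r0 Tv.
  rewrite !lift_cons /= xy eqxx /= /lift_word /edge /= -/(lift_word _ _ _ _).
  have wx s : lwt phi (x, s) = if s then - p else p by rewrite /lwt /= phix.
  rewrite !wx wup (max_idPl p0) (_ : _ + - p = M - `|q|); last lia.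
  rewrite (_ : M - `|q| + `|q| = M); last lia.
  move=> E; apply: (key ([:: ((x, M - `|q|), false)] ++ lift_word phi y (M - `|q| + p) v)).
    by rewrite over_cat oM; move: (low _ sv); rewrite (max_idPl p0).
  apply: rel_trans (rel_catl _ E).
  apply: rel_sym; exact: (rel_catr [:: (x, M, false)] (rel_cancel _ ((x, M - `|q|
    ), false))).
exists [:: up; (x, false); letter_inv up; (x, true)]; split.
  by rewrite !wt_cons wt_nil lwt_inv /lwt /= phix; lia.
move=> v sv Tv; have [_ /(_ (M - `|q| + Num.max p 0))] := lift_rel_eq y r0 Tv.
rewrite !lift_cons /= xy eqxx /= /lift_word /edge /= -/(lift_word _ _ _ _).
have wx s : lwt phi (x, s) = if s then - p else p by rewrite /lwt /= phix.
rewrite lwt_inv !wx wup (max_idPr (ltW p0)) addr0.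
rewrite (_ : M - `|q| + `|q| = M); last lia.
rewrite (_ : _ + - p = M - `|q|); last lia.
move=> E; apply: (key (lift_word phi y (M - `|q|) v ++ [:: ((x, M - `|q|), false)])).
  by rewrite over_cat oM andbT; move: (low _ sv); rewrite (max_idPr (ltW p0)) addr0.
apply: rel_trans (rel_catr _ E).
apply: rel_sym; exact: (rel_catl [:: (x, M, false)] (rel_cancel _ ((x, M - `|q|), true))).
Qed.

Section Transport.
Variables (R : realType) (G : groupType) (r : word 'I_2) (f : G -> pres_group r).
Hypothesis f_bij : bijective f.
Hypothesis fM : {morph f : a b / (a * b)%g}.
Variable phi : 'I_2 -> int.
Hypothesis r0 : wt phi r = 0.

(** The homomorphism given by phi on the generators, transported to G; it does not
    depend on the representative since phi kills r. *)
Definition word_char (g : G) : int := wt phi (repr (f g)).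

Lemma word_charE g u : f g = cls r u -> word_char g = wt phi u.
Proof. by move=> E; apply: (wt_cls r0); rewrite -E; exact: reprK. Qed.

Lemma word_char_additive : additive_char word_char.
Proof.
move=> a b; have [[u Eu] [v Ev]] := (cls_surj (f a), cls_surj (f b)).
rewrite (word_charE Eu) (word_charE Ev) -wt_cat; apply: word_charE.
by rewrite fM Eu Ev cls_cat.
Qed.

Lemma f_surj b : exists a, f a = b.
Proof. by case: f_bij => f' _ f'K; exists (f' b). Qed.

Lemma word_char_nonzero z : phi z != 0 -> exists g, word_char g != 0.
Proof.
move=> z0; have [g Eg] := f_surj (cls r [:: (z, false)]); exists g.
by rewrite (word_charE Eg) wt_cons wt_nil addr0.
Qed.

(** Reading the steps of a path in the Cayley graph, on the generators that
    correspond to the letters, as the letters of a word. *)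
Lemma halfspace_word T z : phi z != 0 -> wt phi T = 0 -> represents_Sigma R word_char ->
  exists2 v, stays phi 0 v & rel_eq (eq r) T v.
Proof.
move=> z0 T0 sig; have [f' fK f'K] := f_bij.
pose S := [seq f' (cls r [:: (i, false)]) | i <- enum 'I_2].
have f1 : f 1%g = 1%g by apply: (mulgI (f 1%g)); rewrite -fM !mulg1.
have fV a : f a^-1%g = (f a)^-1%g by apply: (mulgI (f a)); rewrite -fM !mulgV.
have genS : generates S.
  move=> g H gH SH; have [u Eu] := cls_surj (f g); rewrite -(fK g) {g}Eu.
  have f'M a b : f' (a * b)%g = (f' a * f' b)%g.
    by apply: (can_inj fK); rewrite fM !f'K.
  elim: u => [|l u IH]; first by rewrite cls_nil -f1 fK; case: gH.
  rewrite -cat1s cls_cat f'M; apply: (group_closedM gH) => //.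
  have lS : f' (cls r [:: (l.1, false)]) \in H.
    by apply: SH; apply/mapP; exists l.1; rewrite ?mem_enum.
  case: l lS => i [] //= iS; have -> : [:: (i, true)] = word_inv [:: (i, false)] by [].
  rewrite cls_inv; have ->
    : f' (cls r [:: (i, false)])^-1%g = (f' (cls r [:: (i, false)]))^-1%g.
    by apply: (can_inj fK); rewrite fV !f'K.
  exact: (group_closedV gH).
have nz : nonzero_char (fun g => (word_char g)%:~R : R).
  split; first by move=> a b; rewrite word_char_additive intrD.
  by have [g g0] := word_char_nonzero z0; exists g; rewrite intr_eq0.
have /(SigmaP nz genS) H := sig.
have [t Et] := f_surj (cls r T).
have t0 : word_char t = 0 by rewrite (word_charE Et).
have c1 : word_char 1%g = 0 by rewrite (@word_charE _ [::]) ?wt_nil.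
have [||p [pp pl pn]] := H 1%g t; rewrite ?t0 ?c1 //.
have walk : forall p g, path (cayley_edge S) g p ->
  {in p, forall a, (word_char a)%:~R <= 0 :> R} ->
    exists v, stays phi (word_char g) v /\ f (last g p) = (f g * cls r v)%g.
  elim=> [|h p' IH] g /=; first by exists [::]; rewrite cls_nil mulg1.
  move=> /andP[gh ph] neg; have [|v [sv Ev]] := IH h ph.
    by move=> a ap; apply: neg; rewrite inE ap orbT.
  have [l El] : exists l, f h = (f g * cls r [:: l])%g.
    case/hasP: gh => s /mapP[i _ ->] /orP[/eqP->|/eqP->].
      by exists (i, false); rewrite fM f'K.
    exists (i, true); have -> : [:: (i, true)] = word_inv [:: (i, false)] by [].
    by rewrite fM f'K cls_inv mulgK.
  have hE : word_char h = word_char g + lwt phi l.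
    have [u Eu] := cls_surj (f g); rewrite (word_charE Eu) (@word_charE h (u ++ [:: l])).
      by rewrite wt_cat wt_cons wt_nil addr0.
    by rewrite El Eu cls_cat.
  exists (l :: v); rewrite /= -hE sv andbT; split.
    by have := neg h (mem_head _ _); rewrite lerz0.
  by rewrite Ev El -mulgA -cls_cat.
have [v [sv Ev]] := walk p 1%g pp pn; exists v; first by rewrite -c1.
by apply/pres_rel_eq/cls_eq; rewrite -Et -pl Ev f1 mul1g.
Qed.

End Transport.

Lemma heavy_not_Sigma (R : realType) (G : groupType) (r : word 'I_2)
    (f : G -> pres_group r) (x y : 'I_2) p q :
  bijective f -> {morph f : a b / (a * b)%g} -> cycred r -> x != y ->
  expo x r = 0 -> expo y r = 0 -> q != 0 ->
  heavy_top r (pair_weight x p y q) y x ->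
  exists phi : G -> int,
    [/\ additive_char phi, exists g, phi g != 0 & ~ represents_Sigma R phi].
Proof.
move=> f_bij fM r_red xy x0 y0 q0 heavy.
have r0 : wt (pair_weight x p y q) r = 0 by rewrite wt_pair // x0 y0 !mulr0.
have y1 : pair_weight x p y q y != 0.
  by rewrite pair_weight_r.
have [T [T0 HT]] := heavy_halfspace r_red xy q0 r0 heavy.
exists (word_char f (pair_weight x p y q)); split.
- exact: word_char_additive.
- exact: (word_char_nonzero f_bij r0 y1).
- by move/(halfspace_word f_bij fM r0 y1 T0) => [v sv /(HT v sv)].
Qed.

Theorem corollary1p6 (R : realType) (G : groupType)
    (hG : admits_nice_21_presentation G) :
  iso_Z2 G \/
  exists phi : G -> int,
    [/\ additive_char phi, exists g, phi g != 0 & ~ represents_Sigma R phi].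
Proof.
have [r [[r_nil /cycredP r_red /betti2_expo0 [x0 y0]] [f [f_bij fM]]]] := hG.
apply/or_comm; have [|none] := pselect (exists phi : G -> int,
    [/\ additive_char phi, exists g, phi g != 0 & ~ represents_Sigma R phi]).
  by left.
have xy : ord0 != ord_max :> 'I_2 by [].
have two : over (pred2 (ord0 : 'I_2) ord_max) r.
  by apply/allP => l _ /=; case: (ord2 l.1) => ->; rewrite eqxx ?orbT.
have [||l [m [lm rE]]] := light_commutator r_nil r_red xy two x0 y0.
- by move=> p q q0 /(heavy_not_Sigma R f_bij fM r_red xy x0 y0 q0).
- by move=> p q q0 H; apply: none; apply: (heavy_not_Sigma R f_bij fM r_red _ y0 x0 q0 H).
right; have [h [h_bij hM]] := commutator_Z2 lm rE.
exists (h \o f); split; first exact: bij_comp.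
by move=> a b; rewrite /= fM hM.
Qed.
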